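(* For every oval $C\subset\mathbb{R}^2$ and every $p\in\operatorname{int}(C)$, $$A^*\bigl(\operatorname{ART}_C(p)\bigr)=\frac12\int_0^{\pi}\left(q_p(\theta)^2-q_p'(\theta)^2\right)d\theta\le0.$$ More precisely, if $$q_p(\theta)=\sum_{k\ge1,\ k\text{ odd}}\bigl(a_k\cos(k\theta)+b_k\sin(k\theta)\bigr),$$ then $$A^*\bigl(\operatorname{ART}_C(p)\bigr)=-\frac{\pi}{4}\sum_{k\ge3,\ k\text{ odd}}(k^2-1)(a_k^2+b_k^2).$$ Equality $A^*(\operatorname{ART}_C(p))=0$ holds if and only if $\operatorname{ART}_C(p)$ degenerates to one point.
   Context: An oval is a smooth ($C^\infty$), strictly convex simple closed curve $C\subset\mathbb{R}^2$ with positive curvature; $\operatorname{int}(C)$ is the open region it bounds. For $x\in C$, $\iota_C(x)\in C$ is the unique point different from $x$ whose tangent line is parallel to $T_xC$. $\Phi_C$ sends a line $\overline{xy}$ ($x\ne y\in C$) to $\overline{\iota_C(x)\iota_C(y)}$; $\Lambda_p$ is the pencil of lines through $p$; $\operatorname{ART}_C(p)$ is the envelope of the line family $\Phi_C(\Lambda_p)$. Put $n(\theta)=(\cos\theta,\sin\theta)$, $\tau(\theta)=(-\sin\theta,\cos\theta)$. The normal direction is a global parameter of this family: for each $\theta$ there is exactly one line of $\Phi_C(\Lambda_p)$ with normal $n(\theta)$, written $n(\theta)\cdot(x-p)=q_p(\theta)$, where $q_p$ is smooth and $q_p(\theta+\pi)=-q_p(\theta)$. Then $\operatorname{ART}_C(p)$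 is the closed front $X(\theta)=p+q_p(\theta)n(\theta)+q_p'(\theta)\tau(\theta)$, traced once for $\theta\in[0,\pi]$. For a closed piecewise smooth front $X$, oriented by its line-family parameter, the oriented area is $A^*(X)=\frac12\oint[X,dX]$, where $[u,v]=\det(u,v)$. *)

(* Defs.v *)
From Stdlib Require Export Reals.
From Coquelicot Require Export Coquelicot.
Open Scope R_scope.

Definition plane : Type := (R * R)%type.

Definition padd (u v : plane) : plane := (fst u + fst v, snd u + snd v).
Definition psub (u v : plane) : plane := (fst u - fst v, snd u - snd v).
Definition pscal (r : R) (u : plane) : plane := (r * fst u, r * snd u).
Definition dot (u v : plane) : R := fst u * fst v + snd u * snd v.
Definition det (u v : plane) : R := fst u * snd v - snd u * fst v.

Definition smooth (f : R -> R) : Prop := forall k t, ex_derive_n f k t.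

Definition velocity (g : R -> plane) (t : R) : plane :=
  (Derive (fun s => fst (g s)) t, Derive (fun s => snd (g s)) t).

Definition curvature (g : R -> plane) (t : R) : R :=
  det (velocity g t) (velocity (velocity g) t)
  / sqrt (dot (velocity g t) (velocity g t)) ^ 3.

(* Every point of [C] lies on a line that meets [C] only there and has the
   rest of [C] strictly on one side. *)
Definition strictly_convex (C : plane -> Prop) : Prop :=
  forall P, C P ->
    exists u, forall Q, C Q -> Q <> P -> 0 < dot u (psub Q P).

(* Positive curvature fixes the counterclockwise orientation of [g]. *)
Record oval_parametrization (C : plane -> Prop) (g : R -> plane) (T : R)
  : Prop := {
  op_period_pos : 0 < T;
  op_smooth1 : smooth (fun t => fst (g t));
  op_smooth2 : smooth (fun t => snd (g t));
  op_periodic : forall t, g (t + T) = g t;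
  op_simple : forall s t, 0 <= s < T -> 0 <= t < T -> g s = g t -> s = t;
  op_regular : forall t, velocity g t <> (0, 0);
  op_curvature : forall t, 0 < curvature g t;
  op_image : forall P, C P <-> exists t, P = g t
}.

Definition is_oval (C : plane -> Prop) : Prop :=
  strictly_convex C /\ exists g T, oval_parametrization C g T.

(* The bounded region cut out by [C]: the points off [C] whose path component
   in the complement of [C] is bounded. *)
Definition int_region (C : plane -> Prop) (P : plane) : Prop :=
  ~ C P /\
  exists M : R, forall c : R -> plane,
    (forall t, continuous c t) -> c 0 = P -> (forall t, ~ C (c t)) ->
    forall t, dot (c t) (c t) <= M.

(* [v] is the velocity at [x] of some curve running in [C]. *)
Definition tangent_vector (C : plane -> Prop) (x v : plane) : Prop :=
  exists d : R -> plane,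
    (forall s, C (d s)) /\ d 0 = x /\
    is_derive (fun s => fst (d s)) 0 (fst v) /\
    is_derive (fun s => snd (d s)) 0 (snd v).

(* The graph of iota_C: [antipode C x x'] means x' = iota_C(x). *)
Definition antipode (C : plane -> Prop) (x x' : plane) : Prop :=
  C x /\ C x' /\ x' <> x /\
  exists v v', v <> (0, 0) /\ v' <> (0, 0) /\
    tangent_vector C x v /\ tangent_vector C x' v' /\ det v v' = 0.

Definition line_through (x y : plane) (P : plane) : Prop :=
  det (psub P x) (psub y x) = 0.

(* The graph of Phi_C; lines are sets of points, compared extensionally. *)
Definition Phi (C : plane -> Prop) (L M : plane -> Prop) : Prop :=
  exists x y x' y', C x /\ C y /\ x <> y /\
    (forall P, L P <-> line_through x y P) /\
    antipode C x x' /\ antipode C y y' /\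
    (forall P, M P <-> line_through x' y' P).

Definition pencil (p : plane) (L : plane -> Prop) : Prop :=
  (exists x y, x <> y /\ forall P, L P <-> line_through x y P) /\ L p.

Definition Phi_pencil (C : plane -> Prop) (p : plane) (M : plane -> Prop)
  : Prop := exists L, pencil p L /\ Phi C L M.

Definition nvec (theta : R) : plane := (cos theta, sin theta).
Definition tvec (theta : R) : plane := (- sin theta, cos theta).

Definition normal_line (p : plane) (theta s : R) (P : plane) : Prop :=
  dot (nvec theta) (psub P p) = s.

(* q_p(theta): the s for which [normal_line p theta s] is a line of
   Phi_C(Lambda_p). [iota] is a definite-description operator; for an oval and
   an interior p there is exactly one such s, and q_p is smooth. *)
Definition offset (C : plane -> Prop) (p : plane) (theta : R) : R :=
  @iota R_CompleteSpace (fun s => Phi_pencil C p (normal_line p theta s)).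

(* The envelope of the lines n(theta).(x - p) = q(theta): the point solving
   this equation together with its theta-derivative tau(theta).(x - p) =
   q'(theta). *)
Definition envelope (p : plane) (q : R -> R) (theta : R) : plane :=
  padd p (padd (pscal (q theta) (nvec theta))
               (pscal (Derive q theta) (tvec theta))).

(* One traversal of the front is theta in [0, PI]. *)
Definition ART (C : plane -> Prop) (p : plane) : R -> plane :=
  envelope p (offset C p).

Definition oriented_area (X : R -> plane) (t0 t1 : R) : R :=
  / 2 * RInt (fun t => det (X t) (velocity X t)) t0 t1.

(* Main.v *)
Require Import Defs.
From Stdlib Require Import ZArith Lra Lia Psatz ClassicalEpsilon.

(** Two separate facts make the statement true.

    The offset q is a smooth function with q(t + PI) = - q(t). Write the oval,
    seen from the interior point p, as r(phi), where phi is the angle of the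
    outward normal; strict convexity says that r(phi) is the unique point of
    largest height in the direction n(phi). Then iota_C is the shift of phi by
    PI. A chord through p has a direction angle al; let its ends have normal
    angles f(al) and f(al + PI). The image chord joins the points with normal
    angles f(al) + PI and f(al + PI) + PI. At either end the chord points to
    the inner side of the tangent, so the derivative of the chord turns it
    counterclockwise, and its angle B(al) is strictly increasing
    ([image_chord_angle]). Each of the angles al and B(al) differs
    from f(al), up to a constant, by a function of oscillation less than PI,
    because the corresponding unit vectors have scalar products of constant
    sign. Hence B(al + PI) = B(al) + PI and B is a smooth bijection: for
    each normal direction there is exactly one image line, and its offset is a
    composition of smooth functions ([offset_smooth]).

    The rest is analysis of a smooth antiperiodic q. The envelope X satisfies
    X' = (q + q'') tau, so twice its area is the integral of (q + q'') q, which
    is the integral of q^2 - q'^2 by parts ([envelope_area]). Nonpositivity is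
    Wirtinger's inequality, obtained from
    q'^2 - q^2 = (q' - q cot)^2 + (q^2 cot)', with the cotangent centred at a
    zero of q ([wirtinger]). In the case of equality q minimizes this quadratic
    functional, so the Euler equation q + q'' = 0 holds and X' = 0
    ([wirtinger_equality]).

    For the series, convergence is only assumed pointwise, so that the
    coefficients must first be recognized as Fourier coefficients; this is
    Cantor's uniqueness theory. The coefficients are bounded, by a category
    argument ([cantor_lebesgue_bounded]). The twice formally integrated series
    F therefore converges normally; its symmetric second difference quotients
    tend to q, because the factors (sin x / x)^2 that they introduce have
    bounded variation and Abel summation applies ([riemann_summation]). By
    Schwarz's theorem F'' = q ([riemann_function_smooth]). Integrating the
    normally convergent F term by term, first against each wave and then
    against (q + q'')'', gives the coefficients and the area
    ([trigonometric_energy]). *)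

(** * Smooth functions of one variable *)

(** Recursion through [Derive] lets each closure property be proved by one
    induction that uses the differentiation rule once. *)
Fixpoint Ck (n : nat) (f : R -> R) : Prop :=
  match n with
  | O => forall t, continuous f t
  | S m => (forall t, ex_derive f t) /\ Ck m (Derive f)
  end.

Definition Cinf (f : R -> R) : Prop := forall n, Ck n f.

Lemma Ck_ext n : forall f h, (forall t, f t = h t) -> Ck n f -> Ck n h.
Proof.
  induction n as [|n IH]; simpl; intros f h E H.
  - intros t. apply continuous_ext with f; auto.
  - destruct H as [H1 H2]. split.
    + intros t. apply ex_derive_ext with f; auto.
    + apply IH with (Derive f); auto. intros t. now apply Derive_ext.
Qed.

Lemma Ck_S_is_derive n f f' :
  (forall t, is_derive f t (f' t)) -> Ck n f' -> Ck (S n) f.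
Proof.
  intros D H. split.
  - intros t. now exists (f' t).
  - apply Ck_ext with f'; auto. intros t. symmetry. now apply is_derive_unique.
Qed.

Lemma Ck_S_le n : forall f, Ck (S n) f -> Ck n f.
Proof.
  induction n as [|n IH]; intros f [H1 H2].
  - intros t. now apply (ex_derive_continuous f).
  - split; auto.
Qed.

Lemma Ck_continuous n f : Ck n f -> forall t, continuous f t.
Proof.
  revert f. induction n as [|n IH]; intros f H.
  - exact H.
  - apply IH. now apply Ck_S_le.
Qed.

Lemma Ck_const n c : Ck n (fun _ => c).
Proof.
  revert c. induction n as [|n IH]; intros c.
  - intros t. apply continuous_const.
  - apply Ck_S_is_derive with (fun _ => 0); [|apply IH].
    intros t. apply is_derive_Reals, derivable_pt_lim_const.
Qed.

Lemma Ck_id n : Ck n (fun t => t).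
Proof.
  destruct n as [|n].
  - intros t. apply continuous_id.
  - apply Ck_S_is_derive with (fun _ => 1); [|apply Ck_const].
    intros t. apply is_derive_Reals, derivable_pt_lim_id.
Qed.

Lemma Ck_plus n : forall f h, Ck n f -> Ck n h -> Ck n (fun t => f t + h t).
Proof.
  induction n as [|n IH]; intros f h Hf Hh.
  - intros t. apply (continuous_plus f h); auto.
  - destruct Hf as [Hf1 Hf2], Hh as [Hh1 Hh2].
    apply Ck_S_is_derive with (fun t => Derive f t + Derive h t).
    + intros t. apply (is_derive_plus f h); now apply Derive_correct.
    + now apply IH.
Qed.

Lemma Ck_mult n : forall f h, Ck n f -> Ck n h -> Ck n (fun t => f t * h t).
Proof.
  induction n as [|n IH]; intros f h Hf Hh.
  - intros t. apply (continuous_mult f h); auto.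
  - assert (Hf0 := Ck_S_le _ _ Hf). assert (Hh0 := Ck_S_le _ _ Hh).
    destruct Hf as [Hf1 Hf2], Hh as [Hh1 Hh2].
    apply Ck_S_is_derive with (fun t => Derive f t * h t + f t * Derive h t).
    + intros t. apply (is_derive_mult f h); try now apply Derive_correct.
      intros; apply Rmult_comm.
    + apply Ck_plus; now apply IH.
Qed.

Lemma Ck_opp n f : Ck n f -> Ck n (fun t => - f t).
Proof.
  intros H. apply Ck_ext with (fun t => (-1) * f t).
  - intros; ring.
  - apply Ck_mult; auto. apply Ck_const.
Qed.

Lemma Ck_minus n f h : Ck n f -> Ck n h -> Ck n (fun t => f t - h t).
Proof. intros Hf Hh. apply Ck_plus; auto. now apply Ck_opp. Qed.

Lemma Ck_pow n f k : Ck n f -> Ck n (fun t => f t ^ k).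
Proof.
  intros H. induction k as [|k IH]; simpl.
  - apply Ck_const.
  - now apply Ck_mult.
Qed.

Lemma Ck_comp n : forall f h, Ck n f -> Ck n h -> Ck n (fun t => f (h t)).
Proof.
  induction n as [|n IH]; intros f h Hf Hh.
  - intros t. apply (continuous_comp h f); auto.
  - assert (Hh0 := Ck_S_le _ _ Hh).
    destruct Hf as [Hf1 Hf2], Hh as [Hh1 Hh2].
    apply Ck_S_is_derive with (fun t => Derive h t * Derive f (h t)).
    + intros t. apply (is_derive_comp f h); now apply Derive_correct.
    + apply Ck_mult; auto.
Qed.

(** The derivative - f' / f^2 contains 1 / f itself, which is of class C^n by
    the induction hypothesis. *)
Lemma Ck_inv n : forall f, (forall t, f t <> 0) -> Ck n f -> Ck n (fun t => / f t).
Proof.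
  induction n as [|n IH]; intros f N Hf.
  - intros t. apply continuous_comp with (f := f) (g := Rinv); auto.
    apply (ex_derive_continuous Rinv). auto_derive. apply N.
  - assert (Hf0 := Ck_S_le _ _ Hf). destruct Hf as [Hf1 Hf2].
    apply Ck_S_is_derive with (fun t => - Derive f t * (/ f t * / f t)).
    + intros t.
      replace (- Derive f t * (/ f t * / f t)) with (- Derive f t / f t ^ 2)
        by (field; apply N).
      apply is_derive_inv; [now apply Derive_correct | apply N].
    + apply Ck_mult; [now apply Ck_opp | apply Ck_mult; auto].
Qed.

Lemma Ck_div n f h : (forall t, h t <> 0) -> Ck n f -> Ck n h ->
  Ck n (fun t => f t / h t).
Proof. intros N Hf Hh. apply Ck_mult; auto. now apply Ck_inv. Qed.

Lemma Ck_sin_cos n : Ck n sin /\ Ck n cos.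
Proof.
  induction n as [|n [IS IC]].
  - split; intros t.
    + apply continuous_sin.
    + apply continuous_cos.
  - split.
    + apply Ck_S_is_derive with cos; auto. intros; apply is_derive_sin.
    + apply Ck_S_is_derive with (fun t => - sin t); [|now apply Ck_opp].
      intros; apply is_derive_cos.
Qed.

Lemma Ck_sin n f : Ck n f -> Ck n (fun t => sin (f t)).
Proof. apply Ck_comp, Ck_sin_cos. Qed.

Lemma Ck_cos n f : Ck n f -> Ck n (fun t => cos (f t)).
Proof. apply Ck_comp, Ck_sin_cos. Qed.

(** Transfers the smoothness of the definition of an oval to the form that has
    the closure properties. *)
Lemma smooth_Cinf f : smooth f -> Cinf f.
Proof.
  intros H n. revert f H. induction n as [|n IH]; intros f H.
  - intros t. apply (ex_derive_continuous f). exact (H 1%nat t).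
  - split.
    + intros t. exact (H 1%nat t).
    + apply IH. intros k t. destruct k as [|k]; [exact I|].
      apply ex_derive_ext with (Derive_n f (S k)); [|exact (H (S (S k)) t)].
      intros s. replace (S k) with (k + 1)%nat by lia.
      now rewrite <- (Derive_n_comp f k 1).
Qed.

Lemma Cinf_Derive f : Cinf f -> Cinf (Derive f).
Proof. intros H n. apply (H (S n)). Qed.

Lemma Cinf_ex_derive f t : Cinf f -> ex_derive f t.
Proof. intros H. apply (H 1%nat). Qed.

Lemma Cinf_is_derive f t : Cinf f -> is_derive f t (Derive f t).
Proof. intros H. now apply Derive_correct, Cinf_ex_derive. Qed.

Lemma Cinf_continuous f t : Cinf f -> continuous f t.
Proof. intros H. exact (H 0%nat t). Qed.

Lemma Cinf_of_derivative f f' :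
  (forall t, is_derive f t (f' t)) -> Cinf f' -> Cinf f.
Proof.
  intros D H n. destruct n as [|n].
  - intros t. apply (ex_derive_continuous f). now exists (f' t).
  - apply Ck_S_is_derive with f'; auto.
Qed.

Ltac smooth_tac :=
  repeat match goal with
  | |- Cinf _ => intro
  | |- Ck _ (fun t => _ + _) => apply Ck_plus
  | |- Ck _ (fun t => _ - _) => apply Ck_minus
  | |- Ck _ (fun t => _ * _) => apply Ck_mult
  | |- Ck _ (fun t => _ ^ _) => apply Ck_pow
  | |- Ck _ (fun t => - _) => apply Ck_opp
  | |- Ck _ (fun t => sin _) => apply Ck_sin
  | |- Ck _ (fun t => cos _) => apply Ck_cos
  | |- Ck _ sin => apply Ck_sin_cos
  | |- Ck _ cos => apply Ck_sin_cos
  | |- Ck _ (fun t => t) => apply Ck_id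
  | |- Ck _ (Rmult ?c) => apply (Ck_mult _ (fun _ => c) (fun t => t))
  | |- Ck _ (fun _ => ?c) => apply Ck_const
  | H : Cinf ?f |- Ck _ ?f => exact (H _)
  | H : Cinf ?f |- Ck _ (Derive ?f) => exact (Cinf_Derive f H _)
  | H : Cinf ?f |- Ck _ (fun t => Derive ?f _) =>
      apply (fun n => Ck_comp n (Derive f)); [exact (Cinf_Derive f H _)|]
  | H : Cinf ?f |- Ck _ (fun t => ?f _) =>
      apply (fun n => Ck_comp n f); [exact (H _)|]
  end.

(** * Monotone inverses and polar angles *)

Lemma constant_of_derive0 f :
  (forall t, is_derive f t 0) -> forall x y, f x = f y.
Proof.
  assert (W : forall f : R -> R, (forall t, is_derive f t 0) ->
            forall x y, x < y -> f x = f y).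
  { clear f. intros f D x y L.
    apply eq_is_derive; auto. }
  intros D x y. destruct (Rtotal_order x y) as [L|[->|L]]; auto.
  symmetry; auto.
Qed.

Lemma increasing_of_derive_pos f f' :
  (forall t, is_derive f t (f' t)) -> (forall t, 0 < f' t) ->
  forall x y, x < y -> f x < f y.
Proof.
  intros D P x y L.
  destruct (MVT_gen f x y f') as [z [_ E]].
  - intros; auto.
  - intros t _. apply continuity_pt_filterlim. apply (ex_derive_continuous f).
    now exists (f' t).
  - specialize (P z). nra.
Qed.

Lemma IVT_continuous f x y v :
  (forall t, continuous f t) -> x <= y -> f x <= v <= f y ->
  exists z, x <= z <= y /\ f z = v.
Proof.
  intros Cf L V.
  destruct (IVT_gen f x y v) as [z [Hz Ez]].
  - intros t. apply continuity_pt_filterlim, Cf.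
  - rewrite Rmin_left, Rmax_right; lra.
  - rewrite Rmin_left, Rmax_right in Hz by lra. now exists z.
Qed.

Lemma continuous_eps f x : continuous f x ->
  forall eps, 0 < eps ->
  exists d, 0 < d /\ forall y, Rabs (y - x) < d -> Rabs (f y - f x) < eps.
Proof.
  intros H eps He.
  destruct (proj1 (filterlim_locally _ _) H (mkposreal eps He)) as [d Hd].
  exists d. split; [apply cond_pos|]. intros y Hy. exact (Hd y Hy).
Qed.

Lemma eps_continuous f x :
  (forall eps, 0 < eps ->
   exists d, 0 < d /\ forall y, Rabs (y - x) < d -> Rabs (f y - f x) < eps) ->
  continuous f x.
Proof.
  intros H. apply filterlim_locally. intros eps.
  destruct (H eps (cond_pos eps)) as [d [Hd K]].
  exists (mkposreal d Hd). intros y Hy. apply K. exact Hy.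
Qed.

(** The derivative of the inverse h is 1 / f'(h), so each class C^n of h gives
    the next one. *)
Lemma smooth_inverse f :
  Cinf f -> (forall t, 0 < Derive f t) ->
  (forall v, exists x y, f x <= v <= f y) ->
  exists h, Cinf h /\ (forall x, h (f x) = x) /\ (forall v, f (h v) = v) /\
    (forall v, is_derive h v (/ Derive f (h v))).
Proof.
  intros Hf P U.
  assert (Inc : forall x y, x < y -> f x < f y).
  { apply increasing_of_derive_pos with (Derive f); auto.
    intros; now apply Cinf_is_derive. }
  assert (Ex : forall v, exists x, f x = v).
  { intros v. destruct (U v) as [x [y [Hx Hy]]].
    destruct (Rle_lt_dec x y) as [L|L].
    - destruct (IVT_continuous f x y v) as [z [_ Hz]]; auto.
      + intros; now apply Cinf_continuous.
      + now exists z.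
    - specialize (Inc _ _ L). lra. }
  set (h := fun v => proj1_sig (constructive_indefinite_description _ (Ex v))).
  assert (fh : forall v, f (h v) = v).
  { intros v. unfold h. apply proj2_sig. }
  assert (Inv : forall x y, f x < f y -> x < y).
  { intros x y L. destruct (Rtotal_order x y) as [K|[->|K]]; auto; [lra|].
    specialize (Inc _ _ K). lra. }
  assert (hf : forall x, h (f x) = x).
  { intros x. destruct (Rtotal_order (h (f x)) x) as [K|[K|K]]; auto;
    specialize (Inc _ _ K); rewrite fh in Inc; lra. }
  (* monotonicity turns values of f at h v - eps and h v + eps into the modulus of continuity *)
  assert (Ch : forall v eps, 0 < eps ->
     exists d, 0 < d /\ forall w, Rabs (w - v) < d -> Rabs (h w - h v) < eps).
  { intros v eps He.
    assert (L1 := Inc (h v - eps) (h v) ltac:(lra)).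
    assert (L2 := Inc (h v) (h v + eps) ltac:(lra)).
    rewrite fh in L1, L2.
    exists (Rmin (v - f (h v - eps)) (f (h v + eps) - v)). split.
    - apply Rmin_glb_lt; lra.
    - intros w Hw.
      assert (M1 := Rmin_l (v - f (h v - eps)) (f (h v + eps) - v)).
      assert (M2 := Rmin_r (v - f (h v - eps)) (f (h v + eps) - v)).
      apply Rabs_def2 in Hw.
      assert (h v - eps < h w) by (apply Inv; rewrite fh; lra).
      assert (h w < h v + eps) by (apply Inv; rewrite fh; lra).
      apply Rabs_def1; lra. }
  assert (Dh : forall v, is_derive h v (/ Derive f (h v))).
  { intros v. apply is_derive_Reals. intros eps He.
    assert (Cf' : continuous (fun x => / Derive f x) (h v)).
    { apply (Ck_continuous 0). apply Ck_inv.
      - intros t. specialize (P t). lra.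
      - exact (Cinf_Derive f Hf 0%nat). }
    destruct (continuous_eps _ _ Cf' eps He) as [eta [Heta K]].
    destruct (Ch v eta Heta) as [d [Hd Kd]].
    exists (mkposreal d Hd). intros k Hk0 Hk. simpl in Hk.
    specialize (Kd (v + k)). replace (v + k - v) with k in Kd by ring.
    specialize (Kd Hk).
    destruct (MVT_gen f (h v) (h (v + k)) (Derive f)) as [z [Hz E]].
    - intros; now apply Cinf_is_derive.
    - intros t _. now apply continuity_pt_filterlim, Cinf_continuous.
    - rewrite !fh in E.
      assert (Pz := P z).
      assert (Nz : h (v + k) - h v <> 0).
      { intros Z. rewrite Z in E. lra. }
      replace ((h (v + k) - h v) / k) with (/ Derive f z).
      + apply K. revert Hz Kd. unfold Rmin, Rmax, Rabs.
        repeat destruct Rle_dec; repeat destruct Rcase_abs; lra.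
      + replace (v + k - v) with k in E by ring.
        apply (Rmult_eq_reg_r k); auto.
        replace ((h (v + k) - h v) / k * k) with (h (v + k) - h v)
          by (field; auto).
        apply (Rmult_eq_reg_l (Derive f z)); [|lra].
        rewrite <- E. field. lra. }
  exists h. refine (conj _ (conj hf (conj fh Dh))).
  intros n. induction n as [|n IH].
  - intros v. apply (ex_derive_continuous h). now exists (/ Derive f (h v)).
  - apply Ck_S_is_derive with (fun v => / Derive f (h v)); auto.
    apply Ck_inv.
    + intros v. specialize (P (h v)). lra.
    + apply Ck_comp; auto. exact (Cinf_Derive f Hf n).
Qed.

Lemma is_derive_integral (f : R -> R) t :
  (forall t, continuous f t) -> is_derive (fun x => RInt f 0 x) t (f t).
Proof.
  intros Cf. apply (is_derive_RInt f (fun x => RInt f 0 x) 0 t); auto.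
  apply filter_forall. intros b. apply (RInt_correct f).
  apply (ex_RInt_continuous f). auto.
Qed.

Lemma cos_sin_1 t : cos t * cos t + sin t * sin t = 1.
Proof. generalize (sin2_cos2 t). unfold Rsqr. lra. Qed.

Lemma unit_vector_angle x y :
  x * x + y * y = 1 -> exists t, x = cos t /\ y = sin t.
Proof.
  intros E.
  assert (Hx : -1 <= x <= 1) by nra.
  assert (S : 1 - Rsqr x = Rsqr y) by (unfold Rsqr; lra).
  destruct (Rle_lt_dec 0 y) as [L|L].
  - exists (acos x). rewrite cos_acos, sin_acos by assumption. split; auto.
    rewrite S. now rewrite sqrt_Rsqr.
  - exists (- acos x). rewrite cos_neg, sin_neg, cos_acos, sin_acos by assumption.
    split; auto. rewrite S, Rsqr_neg, sqrt_Rsqr by lra. ring.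
Qed.

(** Integrating the angular speed det(v, v') / |v|^2 from a correct initial
    value gives the angle: the component E of v orthogonal to (cos A, sin A)
    satisfies a linear differential equation for which E^2 / |v|^2 is constant,
    hence zero, and the parallel component D never vanishes, so its sign is the
    initial one. *)
Lemma smooth_polar_angle (v1 v2 : R -> R) :
  Cinf v1 -> Cinf v2 ->
  (forall t, 0 < v1 t * v1 t + v2 t * v2 t) ->
  exists A, Cinf A /\
    (forall t, Derive A t =
       (v1 t * Derive v2 t - v2 t * Derive v1 t) / (v1 t * v1 t + v2 t * v2 t)) /\
    (forall t, exists m, 0 < m /\ v1 t = m * cos (A t) /\ v2 t = m * sin (A t)).
Proof.
  intros H1 H2 P.
  set (om := fun t => (v1 t * Derive v2 t - v2 t * Derive v1 t)
                      / (v1 t * v1 t + v2 t * v2 t)).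
  assert (Hom : Cinf om).
  { intros n. apply Ck_div.
    - intros t. specialize (P t). lra.
    - smooth_tac.
    - smooth_tac. }
  set (N0 := sqrt (v1 0 * v1 0 + v2 0 * v2 0)).
  assert (HN0 : 0 < N0) by (apply sqrt_lt_R0; auto).
  assert (EN0 : N0 * N0 = v1 0 * v1 0 + v2 0 * v2 0).
  { apply sqrt_sqrt. left; auto. }
  destruct (unit_vector_angle (v1 0 / N0) (v2 0 / N0)) as [A0 [E1 E2]].
  { replace (v1 0 / N0 * (v1 0 / N0) + v2 0 / N0 * (v2 0 / N0))
      with ((v1 0 * v1 0 + v2 0 * v2 0) / (N0 * N0)) by (field; lra).
    rewrite EN0. field. specialize (P 0). lra. }
  set (A := fun t => A0 + RInt om 0 t).
  assert (DA : forall t, is_derive A t (om t)).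
  { intros t. unfold A. replace (om t) with (0 + om t) by ring.
    apply (is_derive_plus (fun _ => A0) (fun t => RInt om 0 t)).
    - apply (is_derive_const A0).
    - apply is_derive_integral. intros s. now apply Cinf_continuous. }
  exists A. split; [|split].
  - now apply Cinf_of_derivative with om.
  - intros t. now apply is_derive_unique.
  - set (D := fun t => v1 t * cos (A t) + v2 t * sin (A t)).
    set (E := fun t => v1 t * sin (A t) - v2 t * cos (A t)).
    set (N := fun t => v1 t * v1 t + v2 t * v2 t).
    assert (DE : forall t, E t * E t + D t * D t = N t).
    { intros t. unfold D, E, N. generalize (cos_sin_1 (A t)). intros C.
      transitivity ((v1 t * v1 t + v2 t * v2 t)
         * (cos (A t) * cos (A t) + sin (A t) * sin (A t))); [ring|].
      rewrite C. ring. }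
    assert (EN : forall t, E t * E t / N t = 0).
    { intros t.
      replace 0 with (E 0 * E 0 / N 0).
      - apply (constant_of_derive0 (fun t => E t * E t / N t)).
        intros s. unfold E, N.
        assert (X1 := Cinf_ex_derive v1 s H1).
        assert (X2 := Cinf_ex_derive v2 s H2).
        assert (X3 : ex_derive A s) by (now exists (om s)).
        assert (Ps := P s).
        auto_derive; [repeat split; auto; lra|].
        change (Derive (fun x => A x) s) with (Derive A s).
        change (Derive (fun x => v1 x) s) with (Derive v1 s).
        change (Derive (fun x => v2 x) s) with (Derive v2 s).
        rewrite (is_derive_unique _ _ _ (DA s)). unfold om.
        field. lra.
      - assert (A 0 = A0) as EA.
        { unfold A. rewrite RInt_point. change zero with 0. ring. }
        assert (E 0 = 0) as EE.
        { unfold E. rewrite EA, <- E1, <- E2. field. lra. }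
        rewrite EE. unfold Rdiv. ring. }
    assert (E0 : forall t, E t = 0).
    { intros t. specialize (EN t). assert (Pt := P t). fold (N t) in Pt.
      assert (E t * E t = 0).
      { replace (E t * E t) with (E t * E t / N t * N t) by (field; lra).
        rewrite EN. ring. }
      nra. }
    assert (DN : forall t, D t <> 0).
    { intros t Z. specialize (DE t). rewrite (E0 t), Z in DE.
      assert (Pt := P t). fold (N t) in Pt. lra. }
    assert (CD : forall t, continuous D t).
    { apply (Ck_continuous 0). assert (HA : Cinf A).
      { now apply Cinf_of_derivative with om. }
      unfold D. smooth_tac. }
    assert (D0 : 0 < D 0).
    { unfold D. assert (A 0 = A0) as EA.
      { unfold A. rewrite RInt_point. change zero with 0. ring. }
      rewrite EA, <- E1, <- E2.
      replace (v1 0 * (v1 0 / N0) + v2 0 * (v2 0 / N0))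
        with ((v1 0 * v1 0 + v2 0 * v2 0) / N0) by (field; lra).
      apply Rdiv_lt_0_compat; auto. }
    intros t. exists (D t). split.
    + destruct (Rlt_le_dec 0 (D t)) as [K|K]; auto. exfalso.
      destruct (Rle_lt_dec 0 t) as [L|L].
      * destruct (IVT_continuous (fun s => - D s) 0 t 0) as [z [_ Hz]]; auto.
        -- intros s. apply (continuous_opp D). auto.
        -- lra.
        -- apply (DN z). lra.
      * destruct (IVT_continuous D t 0 0) as [z [_ Hz]]; auto; try lra.
        apply (DN z). lra.
    + specialize (E0 t). unfold D. unfold E in E0.
      assert (C := cos_sin_1 (A t)). split.
      * transitivity (v1 t * (cos (A t) * cos (A t) + sin (A t) * sin (A t))
          - sin (A t) * (v1 t * sin (A t) - v2 t * cos (A t)));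
          [rewrite C, E0; ring | ring].
      * transitivity (v2 t * (cos (A t) * cos (A t) + sin (A t) * sin (A t))
          + cos (A t) * (v1 t * sin (A t) - v2 t * cos (A t)));
          [rewrite C, E0; ring | ring].
Qed.

(** If f took two values at distance at least PI, it would take two values at
    distance exactly PI, where the cosines have opposite signs. Comparing two
    angle functions in this way replaces counting turns. *)
Lemma oscillation_lt_PI (f : R -> R) :
  (forall t, continuous f t) -> (forall t, 0 < cos (f t)) ->
  forall x y, f x - f y < PI.
Proof.
  intros Cf P x y.
  destruct (Rlt_le_dec (f x - f y) PI) as [L|L]; auto. exfalso.
  assert (PI0 := PI_RGT_0).
  assert (Z : exists z, f z = f y + PI).
  { destruct (Rle_lt_dec y x) as [K|K].
    - destruct (IVT_continuous f y x (f y + PI)) as [z [_ Hz]]; auto; [lra|].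
      now exists z.
    - destruct (IVT_continuous (fun s => - f s) x y (- (f y + PI)))
        as [z [_ Hz]]; auto; try lra.
      + intros s. apply (continuous_opp f); auto.
      + exists z. lra. }
  destruct Z as [z Hz]. assert (Pz := P z). assert (Py := P y).
  rewrite Hz, neg_cos in Pz. lra.
Qed.

(** * Parametrizing an oval by the direction of its normal *)

(** The number rho in [np_velocity] is the radius of curvature, and
    [np_support] says that each tangent line supports the curve at one point. *)
Record normal_parametrization (C : plane -> Prop) (c1 c2 : R -> R) : Prop := {
  np_smooth1 : Cinf c1;
  np_smooth2 : Cinf c2;
  np_velocity : forall phi, exists rho, 0 < rho /\
    is_derive c1 phi (- rho * sin phi) /\ is_derive c2 phi (rho * cos phi);
  np_image : forall P, C P <-> exists phi, P = (c1 phi, c2 phi);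
  np_support : forall phi psi, (c1 psi, c2 psi) <> (c1 phi, c2 phi) ->
    dot (nvec phi) (c1 psi, c2 psi) < dot (nvec phi) (c1 phi, c2 phi)
}.

Lemma derive_at_minimum f x l :
  is_derive f x l -> (forall y, f x <= f y) -> l = 0.
Proof.
  intros D M.
  assert (pr : derivable_pt f x).
  { exists l. now apply is_derive_Reals. }
  rewrite <- (is_derive_unique _ _ _ D), <- (Derive_Reals f x pr).
  apply (deriv_minimum f (x - 1) (x + 1)); intros; auto; lra.
Qed.

Lemma Derive_periodic f T :
  Cinf f -> (forall t, f (t + T) = f t) -> forall t, Derive f (t + T) = Derive f t.
Proof.
  intros H P t. symmetry. apply is_derive_unique.
  apply is_derive_ext with (fun s => f (s + T)); [exact P|].
  assert (ex_derive f (t + T)) by now apply Cinf_ex_derive.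
  auto_derive; auto. change (Derive (fun x => f x) (t + T)) with (Derive f (t + T)).
  ring.
Qed.

Lemma unbounded_of_quasiperiodic f T c :
  0 < c -> (forall t, f (t + T) = f t + c) -> forall v, exists x y, f x <= v <= f y.
Proof.
  intros Hc H v.
  assert (K : forall n t, f (t + INR n * T) = f t + INR n * c).
  { induction n as [|n IH]; intros t.
    - simpl. rewrite !Rmult_0_l, !Rplus_0_r. reflexivity.
    - rewrite S_INR. replace (t + (INR n + 1) * T) with (t + INR n * T + T) by ring.
      rewrite H, IH. ring. }
  destruct (INR_archimed c (Rabs (v - f 0)) Hc) as [n Hn].
  exists (0 - INR n * T), (0 + INR n * T).
  assert (K1 := K n 0). assert (K2 := K n (0 - INR n * T)).
  replace (0 - INR n * T + INR n * T) with 0 in K2 by ring.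
  unfold Rabs in Hn. destruct Rcase_abs; lra.
Qed.

Lemma sum_squares_pos x y : (x, y) <> (0, 0) -> 0 < x * x + y * y.
Proof.
  intros H. destruct (Req_dec x 0) as [->|Hx].
  - destruct (Req_dec y 0) as [->|Hy]; [now destruct H | nra].
  - nra.
Qed.

(** The tangent angle A of a parametrization has derivative of the sign of the
    curvature and grows by a fixed amount over a period, so it can be inverted
    and used as the parameter. The line of strict convexity at a point is the
    tangent, and its side is the inner one because the height in the normal
    direction decreases just after the contact. Two
    parameters with the same normal give the same point since a strict maximum
    is unique, and this stands in for the rotation number. *)
Lemma oval_normal_parametrization C :
  is_oval C -> exists c1 c2, normal_parametrization C c1 c2.
Proof.
  intros [SC [g [T [HT S1 S2 Per _ Reg Curv Im]]]].
  set (g1 := fun t => fst (g t)) in *. set (g2 := fun t => snd (g t)) in *.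
  apply smooth_Cinf in S1. apply smooth_Cinf in S2.
  set (v1 := Derive g1). set (v2 := Derive g2).
  assert (H1 : Cinf v1) by now apply Cinf_Derive.
  assert (H2 : Cinf v2) by now apply Cinf_Derive.
  assert (Pos : forall t, 0 < v1 t * v1 t + v2 t * v2 t).
  { intros t. apply sum_squares_pos. exact (Reg t). }
  destruct (smooth_polar_angle v1 v2 H1 H2 Pos) as [A [HA [DA EA]]].
  assert (PA : forall t, 0 < Derive A t).
  { intros t. rewrite DA. apply Rdiv_lt_0_compat; auto.
    specialize (Curv t). unfold curvature, velocity, det in Curv. simpl in Curv.
    fold g1 g2 in Curv. fold v1 v2 in Curv.
    assert (Q : 0 < sqrt (dot (velocity g t) (velocity g t)) ^ 3).
    { apply pow_lt, sqrt_lt_R0. exact (Pos t). }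
    unfold velocity in Q. fold g1 g2 in Q. fold v1 v2 in Q.
    apply (Rmult_lt_compat_r _ _ _ Q) in Curv.
    rewrite Rmult_0_l in Curv. eapply Rlt_le_trans; [exact Curv|].
    right. unfold Rdiv. rewrite Rmult_assoc, Rinv_l, Rmult_1_r; [reflexivity|].
    apply Rgt_not_eq. exact Q. }
  assert (Per1 : forall t, v1 (t + T) = v1 t).
  { apply Derive_periodic; auto. intros t. unfold g1. now rewrite Per. }
  assert (Per2 : forall t, v2 (t + T) = v2 t).
  { apply Derive_periodic; auto. intros t. unfold g2. now rewrite Per. }
  (* the outward normal is the velocity direction turned clockwise by a right angle *)
  set (Th := fun t => A t - PI / 2).
  assert (HTh : Cinf Th) by (unfold Th; smooth_tac).
  assert (DTh : forall t, Derive Th t = Derive A t).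
  { intros t. apply is_derive_unique. unfold Th.
    assert (ex_derive A t) by now apply Cinf_ex_derive.
    auto_derive; auto. change (Derive (fun x => A x) t) with (Derive A t). ring. }
  destruct (smooth_inverse Th) as [u [Hu [uTh [Thu Du]]]].
  - exact HTh.
  - intros t. rewrite DTh. apply PA.
  - apply unbounded_of_quasiperiodic with T (A T - A 0).
    + assert (A 0 < A T); [|lra].
      apply increasing_of_derive_pos with (Derive A); auto.
      intros; now apply Cinf_is_derive.
    + intros t. unfold Th.
      assert (K : A (t + T) - A t = A (0 + T) - A 0).
      { apply (constant_of_derive0 (fun t => A (t + T) - A t)). intros s.
        assert (ex_derive A s) by now apply Cinf_ex_derive.
        assert (ex_derive A (s + T)) by now apply Cinf_ex_derive.
        auto_derive; auto.
        change (Derive (fun x => A x) s) with (Derive A s).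
        change (Derive (fun x => A x) (s + T)) with (Derive A (s + T)).
        rewrite !DA, Per1, Per2, !Derive_periodic by auto. ring. }
      rewrite Rplus_0_l in K. lra.
  - set (c1 := fun phi => g1 (u phi)). set (c2 := fun phi => g2 (u phi)).
    assert (Hc1 : Cinf c1) by (unfold c1; smooth_tac).
    assert (Hc2 : Cinf c2) by (unfold c2; smooth_tac).
    assert (V : forall phi, exists rho, 0 < rho /\
      is_derive c1 phi (- rho * sin phi) /\ is_derive c2 phi (rho * cos phi)).
    { intros phi. destruct (EA (u phi)) as [m [Hm [E1 E2]]].
      assert (Au : A (u phi) = PI / 2 + phi).
      { specialize (Thu phi). unfold Th in Thu. lra. }
      rewrite Au in E1, E2.
      rewrite <- cos_sin in E2.
      replace (cos (PI / 2 + phi)) with (- sin phi) in E1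
        by (rewrite sin_cos; ring).
      exists (/ Derive Th (u phi) * m). split; [|split].
      - apply Rmult_lt_0_compat; auto. apply Rinv_0_lt_compat.
        rewrite DTh. apply PA.
      - replace (- (/ Derive Th (u phi) * m) * sin phi)
          with (/ Derive Th (u phi) * v1 (u phi)) by (rewrite E1; ring).
        apply (is_derive_comp g1 u); auto. now apply Cinf_is_derive.
      - replace (/ Derive Th (u phi) * m * cos phi)
          with (/ Derive Th (u phi) * v2 (u phi)) by (rewrite E2; ring).
        apply (is_derive_comp g2 u); auto. now apply Cinf_is_derive. }
    assert (I : forall P, C P <-> exists phi, P = (c1 phi, c2 phi)).
    { intros P. rewrite Im. unfold c1, c2, g1, g2. split.
      - intros [t ->]. exists (Th t). rewrite uTh. now destruct (g t).
      - intros [phi ->]. exists (u phi). now destruct (g (u phi)). }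
    exists c1, c2. split; auto.
    intros phi.
    destruct (SC (c1 phi, c2 phi)) as [d Hd].
    { apply I. now exists phi. }
    set (h := fun psi => cos phi * (c1 psi - c1 phi) + sin phi * (c2 psi - c2 phi)).
    set (f := fun psi => fst d * (c1 psi - c1 phi) + snd d * (c2 psi - c2 phi)).
    assert (Hf : forall psi, (c1 psi, c2 psi) <> (c1 phi, c2 phi) -> 0 < f psi).
    { intros psi N. apply (Hd (c1 psi, c2 psi)); auto. apply I. now exists psi. }
    assert (Hperp : - fst d * sin phi + snd d * cos phi = 0).
    { destruct (V phi) as [rho [Hrho [D1 D2]]].
      assert (Z : fst d * (- rho * sin phi) + snd d * (rho * cos phi) = 0).
      { apply (derive_at_minimum f phi).
        - unfold f.
          assert (X1 : ex_derive c1 phi) by now apply Cinf_ex_derive.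
          assert (X2 : ex_derive c2 phi) by now apply Cinf_ex_derive.
          auto_derive; auto.
          change (Derive (fun x => c1 x) phi) with (Derive c1 phi).
          change (Derive (fun x => c2 x) phi) with (Derive c2 phi).
          rewrite (is_derive_unique _ _ _ D1), (is_derive_unique _ _ _ D2). ring.
        - intros psi. replace (f phi) with 0 by (unfold f; ring).
          destruct (classic ((c1 psi, c2 psi) = (c1 phi, c2 phi))) as [E|E].
          + injection E as E1 E2. unfold f. rewrite E1, E2. right; ring.
          + left. auto. }
      apply (Rmult_eq_reg_l rho); [|lra]. rewrite Rmult_0_r, <- Z. ring. }
    (* orthogonal to the tangent, the vector d is k times the outward normal; k < 0 is shown next *)
    set (k := fst d * cos phi + snd d * sin phi).
    assert (Fk : forall psi, f psi = k * h psi).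
    { intros psi. unfold f, k, h. assert (X := cos_sin_1 phi).
      transitivity ((cos phi * cos phi + sin phi * sin phi)
        * (fst d * (c1 psi - c1 phi) + snd d * (c2 psi - c2 phi))
        + (- fst d * sin phi + snd d * cos phi) *
          (sin phi * (c1 psi - c1 phi) - cos phi * (c2 psi - c2 phi)));
      [rewrite X, Hperp; ring | ring]. }
    assert (Hh1 : h (phi + 1) < 0).
    { destruct (MVT_cor2 h (Derive h) phi (phi + 1)) as [z [Ez Hz]].
      - lra.
      - intros z _. apply is_derive_Reals, Cinf_is_derive. unfold h. smooth_tac.
      - replace (h phi) with 0 in Ez by (unfold h; ring).
        destruct (V z) as [rho [Hrho [D1 D2]]].
        assert (X1 : ex_derive c1 z) by now apply Cinf_ex_derive.
        assert (X2 : ex_derive c2 z) by now apply Cinf_ex_derive.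
        assert (Dh : Derive h z = - (rho * sin (z - phi))).
        { apply is_derive_unique. unfold h. auto_derive; auto.
          change (Derive (fun x => c1 x) z) with (Derive c1 z).
          change (Derive (fun x => c2 x) z) with (Derive c2 z).
          rewrite (is_derive_unique _ _ _ D1), (is_derive_unique _ _ _ D2).
          rewrite sin_minus. ring. }
        assert (0 < sin (z - phi)).
        { apply sin_gt_0; [lra|]. generalize PI2_1. lra. }
        assert (0 < rho * sin (z - phi)) by now apply Rmult_lt_0_compat.
        rewrite Dh in Ez. lra. }
    assert (Hk : k < 0).
    { assert (X : 0 < f (phi + 1)).
      { apply Hf. intros E. injection E as E1 E2.
        unfold h in Hh1. rewrite E1, E2 in Hh1. lra. }
      rewrite Fk in X. nra. }
    intros psi N. apply Hf in N. rewrite Fk in N.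
    assert (h psi < 0) by nra.
    unfold h in *. unfold dot, nvec. simpl. lra.
Qed.

Lemma continuous_pair (f h : R -> R) t :
  continuous f t -> continuous h t -> continuous (fun s => (f s, h s)) t.
Proof.
  intros Hf Hh. apply filterlim_locally. intros eps.
  generalize (filter_and _ _ (proj1 (filterlim_locally _ _) Hf eps)
                             (proj1 (filterlim_locally _ _) Hh eps)).
  apply filter_imp. intros x [K1 K2]. now split.
Qed.

(** Otherwise p is at least as high as the contact point in some normal
    direction n, and the ray p + t^2 n never meets the curve: it would be an
    unbounded path in the complement. *)
Lemma interior_support C c1 c2 p :
  normal_parametrization C c1 c2 -> int_region C p ->
  forall phi, 0 < dot (nvec phi) (c1 phi - fst p, c2 phi - snd p).
Proof.
  intros NP [Hp [M HM]] phi.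
  destruct (Rlt_le_dec 0 (dot (nvec phi) (c1 phi - fst p, c2 phi - snd p)))
    as [L|L]; auto. exfalso.
  set (c := fun t : R => (fst p + t * t * cos phi, snd p + t * t * sin phi) : plane).
  assert (Hc : forall t, ~ C (c t)).
  { intros t HC. assert (HC' := HC). apply (np_image _ _ _ NP) in HC'.
    destruct HC' as [psi Epsi].
    destruct (classic ((c1 psi, c2 psi) = (c1 phi, c2 phi))) as [E|N].
    - rewrite E in Epsi. unfold c in Epsi. injection Epsi as E1 E2.
      unfold dot, nvec in L. simpl in L. rewrite <- E1, <- E2 in L.
      assert (X := cos_sin_1 phi).
      assert (t * t * (cos phi * cos phi + sin phi * sin phi) <= 0) by lra.
      rewrite X in H. assert (t = 0) by nra. subst t.
      apply Hp. replace p with (c 0); auto. unfold c. destruct p; simpl.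
      f_equal; ring.
    - apply (np_support _ _ _ NP) in N. rewrite <- Epsi in N.
      unfold c, dot, nvec in N, L. simpl in N, L.
      assert (X := cos_sin_1 phi).
      assert (Y : t * t * (cos phi * cos phi + sin phi * sin phi) < 0) by lra.
      rewrite X in Y. nra. }
  assert (B : forall t, dot (c t) (c t) <= M).
  { apply HM; auto.
    - intros t. apply continuous_pair; apply (ex_derive_continuous (V := R_NormedModule));
      auto_derive; auto.
    - unfold c. destruct p; simpl. f_equal; ring. }
  set (d := dot (nvec phi) p).
  (* at this parameter the height of the path exceeds abs M + 1, hence its square exceeds M *)
  set (s := sqrt (Rabs d + Rabs M + 1)).
  assert (Es : s * s = Rabs d + Rabs M + 1).
  { apply sqrt_sqrt. generalize (Rabs_pos d) (Rabs_pos M). lra. }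
  specialize (B s).
  assert (Cauchy : (d + s * s) * (d + s * s) <= dot (c s) (c s)).
  { assert (X := cos_sin_1 phi).
    unfold c, d, dot, nvec. simpl.
    assert (Y : cos phi * fst p + sin phi * snd p + s * s =
      cos phi * (fst p + s * s * cos phi) + sin phi * (snd p + s * s * sin phi)).
    { transitivity (cos phi * fst p + sin phi * snd p
        + s * s * (cos phi * cos phi + sin phi * sin phi)); [rewrite X|]; ring. }
    rewrite Y.
    generalize (fst p + s * s * cos phi) (snd p + s * s * sin phi). intros x y.
    assert (0 <= (cos phi * y - sin phi * x) * (cos phi * y - sin phi * x))
      by apply (Rle_0_sqr (cos phi * y - sin phi * x)).
    assert ((cos phi * x + sin phi * y) * (cos phi * x + sin phi * y)
      + (cos phi * y - sin phi * x) * (cos phi * y - sin phi * x) = x * x + y * y).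
    { transitivity ((cos phi * cos phi + sin phi * sin phi) * (x * x + y * y));
      [|rewrite X]; ring. }
    lra. }
  assert (Rabs M + 1 <= d + s * s).
  { rewrite Es. generalize (Rle_abs (- d)). rewrite Rabs_Ropp. lra. }
  assert (M <= Rabs M) by apply Rle_abs.
  assert (0 <= Rabs M) by apply Rabs_pos.
  nra.
Qed.

(** * Antipodes and rays from the interior point *)

(** The normal parametrization with the interior point as origin; [cp_interior]
    then says that the origin lies strictly inside every tangent line. *)
Record centred_parametrization (C : plane -> Prop) (p : plane) (r1 r2 : R -> R)
  : Prop := {
  cp_smooth1 : Cinf r1;
  cp_smooth2 : Cinf r2;
  cp_velocity : forall phi, exists rho, 0 < rho /\
    is_derive r1 phi (- rho * sin phi) /\ is_derive r2 phi (rho * cos phi);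
  cp_image : forall P, C P <-> exists phi, P = padd p (r1 phi, r2 phi);
  cp_support : forall phi psi, (r1 psi, r2 psi) <> (r1 phi, r2 phi) ->
    dot (nvec phi) (r1 psi, r2 psi) < dot (nvec phi) (r1 phi, r2 phi);
  cp_interior : forall phi, 0 < dot (nvec phi) (r1 phi, r2 phi)
}.

Lemma oval_centred_parametrization C p :
  is_oval C -> int_region C p -> exists r1 r2, centred_parametrization C p r1 r2.
Proof.
  intros HC Hp. destruct (oval_normal_parametrization C HC) as [c1 [c2 NP]].
  assert (Int := interior_support C c1 c2 p NP Hp).
  exists (fun phi => c1 phi - fst p), (fun phi => c2 phi - snd p).
  assert (S1 := np_smooth1 _ _ _ NP). assert (S2 := np_smooth2 _ _ _ NP).
  split.
  - smooth_tac.
  - smooth_tac.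
  - intros phi. destruct (np_velocity _ _ _ NP phi) as [rho [Hr [D1 D2]]].
    exists rho. split; [exact Hr|].
    split; [rewrite <- (Rminus_0_r (- rho * sin phi))
           | rewrite <- (Rminus_0_r (rho * cos phi))].
    + apply (is_derive_minus c1 (fun _ => fst p)); auto. apply (is_derive_const (fst p)).
    + apply (is_derive_minus c2 (fun _ => snd p)); auto. apply (is_derive_const (snd p)).
  - intros P. rewrite (np_image _ _ _ NP).
    split; intros [phi ->]; exists phi; unfold padd; simpl; f_equal; ring.
  - intros phi psi N.
    assert (K : (c1 psi, c2 psi) <> (c1 phi, c2 phi)).
    { intros E. apply N. now injection E as -> ->. }
    apply (np_support _ _ _ NP) in K. unfold dot in *. simpl in *. lra.
  - exact Int.
Qed.

Lemma nvec_opposite t : nvec (t + PI) = pscal (-1) (nvec t).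
Proof. unfold nvec, pscal. rewrite neg_cos, neg_sin. simpl. f_equal; ring. Qed.

Lemma nvec_eq_opposite s t : nvec s = nvec t -> nvec (s + PI) = nvec (t + PI).
Proof. intros E. now rewrite !nvec_opposite, E. Qed.

Lemma nvec_of_sin0 s t : sin (s - t) = 0 -> nvec s = pscal (cos (s - t)) (nvec t).
Proof.
  intros E. unfold nvec, pscal. simpl.
  replace s with (t + (s - t)) at 1 2 by ring.
  rewrite cos_plus, sin_plus, E. f_equal; ring.
Qed.

Lemma nvec_parallel s t : sin (s - t) = 0 -> nvec s = nvec t \/ nvec s = nvec (t + PI).
Proof.
  intros E. rewrite nvec_opposite, (nvec_of_sin0 s t E).
  assert (X := cos_sin_1 (s - t)). rewrite E in X.
  assert (Y : (cos (s - t) - 1) * (cos (s - t) + 1) = 0) by lra.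
  apply Rmult_integral in Y. destruct Y as [Y|Y].
  - left. replace (cos (s - t)) with 1 by lra. unfold pscal, nvec. simpl. f_equal; ring.
  - right. f_equal. lra.
Qed.

Lemma periodic_nvec (f : R -> R) :
  (forall t, f (t + 2 * PI) = f t) -> forall s t, nvec s = nvec t -> f s = f t.
Proof.
  intros P s t E. injection E as E1 E2.
  assert (X : cos (s - t) = 1).
  { rewrite cos_minus, E1, E2. apply cos_sin_1. }
  assert (Y : sin ((s - t) / 2) = 0).
  { replace (s - t) with (2 * ((s - t) / 2)) in X by field.
    rewrite cos_2a_sin in X. nra. }
  assert (N : forall n u, f (u + INR n * (2 * PI)) = f u).
  { induction n as [|n IH]; intros u.
    - simpl. now rewrite Rmult_0_l, Rplus_0_r.
    - rewrite S_INR. replace (u + (INR n + 1) * (2 * PI))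
        with (u + INR n * (2 * PI) + 2 * PI) by ring. now rewrite P. }
  apply sin_eq_0_0 in Y. destruct Y as [k Hk].
  destruct (Z_le_gt_dec 0 k) as [K|K].
  - rewrite <- (N (Z.to_nat k) t). f_equal.
    rewrite INR_IZR_INZ, Z2Nat.id by lia. lra.
  - rewrite <- (N (Z.to_nat (- k)) s). f_equal.
    rewrite INR_IZR_INZ, Z2Nat.id, opp_IZR by lia. lra.
Qed.

Lemma support_le C p r1 r2 : centred_parametrization C p r1 r2 -> forall phi psi,
  dot (nvec phi) (r1 psi, r2 psi) <= dot (nvec phi) (r1 phi, r2 phi).
Proof.
  intros CP phi psi. destruct (classic ((r1 psi, r2 psi) = (r1 phi, r2 phi))) as [E|E].
  - rewrite E. apply Rle_refl.
  - left. now apply (cp_support _ _ _ _ CP).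
Qed.

Lemma same_normal_same_point C p r1 r2 : centred_parametrization C p r1 r2 ->
  forall phi psi, nvec psi = nvec phi -> (r1 psi, r2 psi) = (r1 phi, r2 phi).
Proof.
  intros CP phi psi E. apply NNPP. intros N.
  assert (L1 := cp_support _ _ _ _ CP phi psi N).
  assert (L2 := support_le _ _ _ _ CP psi phi). rewrite E in L2. lra.
Qed.

(** The normals are parallel, and opposite ones cannot both have a positive
    product with the same vector from the origin. *)
Lemma contact_normal C p r1 r2 : centred_parametrization C p r1 r2 ->
  forall phi psi, sin (psi - phi) = 0 -> (r1 psi, r2 psi) = (r1 phi, r2 phi) ->
  nvec psi = nvec phi.
Proof.
  intros CP phi psi S E.
  destruct (nvec_parallel psi phi S) as [H|H]; auto. exfalso.
  assert (L1 := cp_interior _ _ _ _ CP phi).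
  assert (L2 := cp_interior _ _ _ _ CP psi).
  rewrite H, nvec_opposite, E in L2. unfold dot, pscal in *. simpl in *. lra.
Qed.

Lemma is_derive_dot u f1 f2 t l1 l2 : is_derive f1 t l1 -> is_derive f2 t l2 ->
  is_derive (fun s => dot u (f1 s, f2 s)) t (dot u (l1, l2)).
Proof.
  intros D1 D2. unfold dot. cbn [fst snd].
  assert (X1 : ex_derive f1 t) by now exists l1.
  assert (X2 : ex_derive f2 t) by now exists l2.
  auto_derive; auto.
  change (Derive (fun x => f1 x) t) with (Derive f1 t).
  change (Derive (fun x => f2 x) t) with (Derive f2 t).
  rewrite (is_derive_unique _ _ _ D1), (is_derive_unique _ _ _ D2). ring.
Qed.

(** The height in direction n(phi) is also maximal at the parameter psi, hence
    stationary there. *)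
Lemma same_point_same_normal C p r1 r2 : centred_parametrization C p r1 r2 ->
  forall phi psi, (r1 psi, r2 psi) = (r1 phi, r2 phi) -> nvec psi = nvec phi.
Proof.
  intros CP phi psi E. apply (contact_normal _ _ _ _ CP); auto.
  destruct (cp_velocity _ _ _ _ CP psi) as [rho [Hr [D1 D2]]].
  assert (Z : - dot (nvec phi) (- rho * sin psi, rho * cos psi) = 0).
  { apply (derive_at_minimum (fun s => - dot (nvec phi) (r1 s, r2 s)) psi).
    - apply (is_derive_opp (fun s => dot (nvec phi) (r1 s, r2 s))).
      now apply is_derive_dot.
    - intros s. rewrite E. generalize (support_le _ _ _ _ CP phi s). lra. }
  unfold dot, nvec in Z. simpl in Z.
  rewrite sin_minus. apply (Rmult_eq_reg_l rho); [|lra].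
  rewrite Rmult_0_r, <- Z. ring.
Qed.

(** A curve running in C through the contact point has stationary height there. *)
Lemma tangent_vector_normal C p r1 r2 : centred_parametrization C p r1 r2 ->
  forall phi v, tangent_vector C (padd p (r1 phi, r2 phi)) v -> dot (nvec phi) v = 0.
Proof.
  intros CP phi v [d [Hd [H0 [D1 D2]]]].
  assert (Z : - dot (nvec phi) v = 0).
  { apply (derive_at_minimum (fun s => - dot (nvec phi) (d s)) 0).
    - apply (is_derive_opp (fun s => dot (nvec phi) (d s))).
      destruct v. exact (is_derive_dot _ _ _ _ _ _ D1 D2).
    - intros s. rewrite H0. destruct (proj1 (cp_image _ _ _ _ CP _) (Hd s)) as [psi ->].
      generalize (support_le _ _ _ _ CP phi psi). unfold dot, padd. simpl. lra. }
  lra.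
Qed.

Lemma tangent_vector_velocity C p r1 r2 : centred_parametrization C p r1 r2 ->
  forall phi, exists rho, 0 < rho /\
    tangent_vector C (padd p (r1 phi, r2 phi)) (pscal rho (tvec phi)).
Proof.
  intros CP phi. destruct (cp_velocity _ _ _ _ CP phi) as [rho [Hr [D1 D2]]].
  exists rho. split; auto.
  exists (fun s => padd p (r1 (phi + s), r2 (phi + s))). split; [|split; [|split]].
  - intros s. apply (cp_image _ _ _ _ CP). now exists (phi + s).
  - now rewrite Rplus_0_r.
  - unfold padd, pscal, tvec. cbn [fst snd].
    assert (X1 : ex_derive r1 (phi + 0)) by (rewrite Rplus_0_r; now exists (- rho * sin phi)).
    auto_derive; auto. rewrite Rplus_0_r.
    change (Derive (fun x => r1 x) phi) with (Derive r1 phi).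
    rewrite (is_derive_unique _ _ _ D1). ring.
  - unfold padd, pscal, tvec. cbn [fst snd].
    assert (X2 : ex_derive r2 (phi + 0)) by (rewrite Rplus_0_r; now exists (rho * cos phi)).
    auto_derive; auto. rewrite Rplus_0_r.
    change (Derive (fun x => r2 x) phi) with (Derive r2 phi).
    rewrite (is_derive_unique _ _ _ D2). ring.
Qed.

Lemma orthogonal_nvec t v : dot (nvec t) v = 0 -> v = pscal (dot (tvec t) v) (tvec t).
Proof.
  destruct v as [x y]. unfold dot, nvec, tvec, pscal. simpl. intros E.
  assert (X := cos_sin_1 t). f_equal.
  - transitivity (x * (cos t * cos t + sin t * sin t)
      - cos t * (cos t * x + sin t * y)); [rewrite X, E; ring|ring].
  - transitivity (y * (cos t * cos t + sin t * sin t)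
      - sin t * (cos t * x + sin t * y)); [rewrite X, E; ring|ring].
Qed.

(** Parallel tangents mean equal or opposite normals, and equal normals would
    give the same point; so iota_C is the shift of the normal angle by PI. *)
Lemma antipode_iff C p r1 r2 : centred_parametrization C p r1 r2 -> forall x x',
  antipode C x x' <->
  exists phi, x = padd p (r1 phi, r2 phi) /\
              x' = padd p (r1 (phi + PI), r2 (phi + PI)).
Proof.
  intros CP x x'. split.
  - intros [Cx [Cx' [N [v [v' [Nv [Nv' [Tv [Tv' D]]]]]]]]].
    apply (cp_image _ _ _ _ CP) in Cx. destruct Cx as [phi ->].
    apply (cp_image _ _ _ _ CP) in Cx'. destruct Cx' as [psi ->].
    apply (tangent_vector_normal _ _ _ _ CP), orthogonal_nvec in Tv.
    apply (tangent_vector_normal _ _ _ _ CP), orthogonal_nvec in Tv'.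
    set (k := dot (tvec phi) v) in *. set (k' := dot (tvec psi) v') in *.
    assert (Hk : k <> 0).
    { intros Z. apply Nv. rewrite Tv, Z. unfold pscal. f_equal; ring. }
    assert (Hk' : k' <> 0).
    { intros Z. apply Nv'. rewrite Tv', Z. unfold pscal. f_equal; ring. }
    assert (S : sin (psi - phi) = 0).
    { apply (Rmult_eq_reg_l (k * k')); [|now apply Rmult_integral_contrapositive].
      rewrite Rmult_0_r, <- D, Tv, Tv'. rewrite sin_minus.
      unfold det, pscal, tvec. simpl. ring. }
    exists phi. split; auto.
    destruct (nvec_parallel psi phi S) as [H|H].
    + destruct N. now rewrite (same_normal_same_point _ _ _ _ CP phi psi H).
    + now rewrite (same_normal_same_point _ _ _ _ CP (phi + PI) psi H).
  - intros [phi [-> ->]].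
    destruct (tangent_vector_velocity _ _ _ _ CP phi) as [k [Hk Tk]].
    destruct (tangent_vector_velocity _ _ _ _ CP (phi + PI)) as [k' [Hk' Tk']].
    assert (NZ : forall t k, 0 < k -> pscal k (tvec t) <> (0, 0)).
    { clear. intros t k Hk E. injection E as E1 E2. assert (X := cos_sin_1 t).
      assert (k * k * (cos t * cos t + sin t * sin t) = 0).
      { transitivity ((k * - sin t) * (k * - sin t) + (k * cos t) * (k * cos t));
        [ring | rewrite E1, E2; ring]. }
      rewrite X in H. nra. }
    repeat split.
    + apply (cp_image _ _ _ _ CP). now exists phi.
    + apply (cp_image _ _ _ _ CP). now exists (phi + PI).
    + intros E.
      assert (L1 := cp_interior _ _ _ _ CP phi).
      assert (L2 := cp_interior _ _ _ _ CP (phi + PI)).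
      rewrite nvec_opposite in L2.
      unfold padd in E. injection E as E1 E2.
      apply Rplus_eq_reg_l in E1. apply Rplus_eq_reg_l in E2.
      rewrite E1, E2 in L2. unfold dot, pscal in *. simpl in *. lra.
    + exists (pscal k (tvec phi)), (pscal k' (tvec (phi + PI))).
      split; [|split; [|split; [|split]]]; auto.
      unfold det, pscal, tvec. simpl. rewrite neg_cos, neg_sin. ring.
Qed.

(** If one point is k times the other, comparing heights in the two normal
    directions gives k <= 1 and k >= 1. So the curve is starshaped about the
    interior point. *)
Lemma same_ray_same_point C p r1 r2 : centred_parametrization C p r1 r2 ->
  forall phi psi k, 0 < k -> (r1 psi, r2 psi) = pscal k (r1 phi, r2 phi) ->
  (r1 psi, r2 psi) = (r1 phi, r2 phi).
Proof.
  intros CP phi psi k Hk E.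
  assert (P1 := cp_interior _ _ _ _ CP phi).
  assert (P2 := cp_interior _ _ _ _ CP psi).
  assert (L1 := support_le _ _ _ _ CP phi psi).
  assert (L2 := support_le _ _ _ _ CP psi phi).
  assert (E1 : dot (nvec phi) (r1 psi, r2 psi) = k * dot (nvec phi) (r1 phi, r2 phi)).
  { rewrite E. unfold dot, pscal. simpl. ring. }
  assert (E2 : dot (nvec psi) (r1 psi, r2 psi) = k * dot (nvec psi) (r1 phi, r2 phi)).
  { rewrite E. unfold dot, pscal. simpl. ring. }
  assert (k = 1).
  { rewrite E1 in L1. rewrite E2 in L2, P2. nra. }
  subst k. rewrite E. unfold pscal. simpl. f_equal; ring.
Qed.

(** * Chords through the interior point and their images *)

Lemma dot_pscal_nvec k s t : dot (nvec s) (pscal k (nvec t)) = k * cos (s - t).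
Proof. unfold dot, nvec, pscal. rewrite cos_minus. simpl. ring. Qed.

Lemma nonzero_of_dot u v : dot u v <> 0 -> 0 < fst v * fst v + snd v * snd v.
Proof.
  intros H. apply sum_squares_pos. intros E. apply H. unfold dot.
  injection E as -> ->. ring.
Qed.

(** Since det(r, r') = rho (n . r) > 0, the polar angle A of the curve seen from
    the origin is strictly increasing; f is its inverse, the normal angle as a
    function of the polar angle. The last clause compares the two angles through
    n . r > 0 and is also what makes A surjective. *)
Lemma polar_inverse C p r1 r2 : centred_parametrization C p r1 r2 ->
  exists A f, Cinf f /\
    (forall phi, f (A phi) = phi) /\
    (forall phi, exists m, 0 < m /\ (r1 phi, r2 phi) = pscal m (nvec (A phi))) /\
    (forall al, exists m, 0 < m /\ (r1 (f al), r2 (f al)) = pscal m (nvec al)) /\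
    (forall al, exists k, 0 < k /\ is_derive f al k) /\
    (forall al be, (al - f al) - (be - f be) < PI).
Proof.
  intros CP. assert (H1 := cp_smooth1 _ _ _ _ CP). assert (H2 := cp_smooth2 _ _ _ _ CP).
  assert (Pos : forall t, 0 < r1 t * r1 t + r2 t * r2 t).
  { intros t. apply (nonzero_of_dot (nvec t) (r1 t, r2 t)).
    apply Rgt_not_eq, (cp_interior _ _ _ _ CP). }
  destruct (smooth_polar_angle r1 r2 H1 H2 Pos) as [A [HA [DA EA]]].
  assert (EA' : forall phi, exists m, 0 < m /\ (r1 phi, r2 phi) = pscal m (nvec (A phi))).
  { intros phi. destruct (EA phi) as [m [Hm [-> ->]]]. now exists m. }
  assert (PA : forall t, 0 < Derive A t).
  { intros t. rewrite DA. apply Rdiv_lt_0_compat; auto.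
    destruct (cp_velocity _ _ _ _ CP t) as [rho [Hr [D1 D2]]].
    rewrite (is_derive_unique _ _ _ D1), (is_derive_unique _ _ _ D2).
    apply Rlt_le_trans with (rho * dot (nvec t) (r1 t, r2 t)).
    - apply Rmult_lt_0_compat; auto. apply (cp_interior _ _ _ _ CP).
    - right. unfold dot, nvec. simpl. ring. }
  assert (Osc : forall x y, (A x - x) - (A y - y) < PI).
  { apply (oscillation_lt_PI (fun x => A x - x)).
    - apply (Ck_continuous 0). smooth_tac.
    - intros t. assert (I := cp_interior _ _ _ _ CP t).
      destruct (EA' t) as [m [Hm E]]. rewrite E, dot_pscal_nvec in I.
      replace (cos (A t - t)) with (cos (t - A t)).
      + nra.
      + rewrite <- cos_neg. f_equal. ring. }
  destruct (smooth_inverse A HA PA) as [f [Hf [fA [Af Df]]]].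
  { intros v. exists (v - A 0 - PI), (v - A 0 + PI).
    assert (O1 := Osc (v - A 0 - PI) 0). assert (O2 := Osc 0 (v - A 0 + PI)). lra. }
  exists A, f. split; [exact Hf|]. split; [exact fA|]. split; [exact EA'|]. split; [|split].
  - intros al. destruct (EA' (f al)) as [m Hm]. rewrite Af in Hm. now exists m.
  - intros al. exists (/ Derive A (f al)). split; auto. now apply Rinv_0_lt_compat.
  - intros al be. assert (O := Osc (f al) (f be)). rewrite !Af in O. exact O.
Qed.

Lemma opposite_ends C p r1 r2 f : centred_parametrization C p r1 r2 ->
  (forall al, exists m, 0 < m /\ (r1 (f al), r2 (f al)) = pscal m (nvec al)) ->
  forall al, nvec (f al) <> nvec (f (al + PI)).
Proof.
  intros CP Hf al E.
  apply (same_normal_same_point _ _ _ _ CP) in E.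
  destruct (Hf al) as [m [Hm Em]]. destruct (Hf (al + PI)) as [m' [Hm' Em']].
  rewrite Em, Em', nvec_opposite in E. unfold pscal, nvec in E. simpl in E.
  injection E as E1 E2. assert (X := cos_sin_1 al).
  assert (Y : (m + m') * (cos al * cos al + sin al * sin al) = 0).
  { transitivity (cos al * (m * cos al - m' * (-1 * cos al))
      + sin al * (m * sin al - m' * (-1 * sin al))); [ring|].
    rewrite E1, E2. ring. }
  rewrite X in Y. lra.
Qed.

(** With w(al) the vector between the two antipodes of the ends of the chord of
    direction al, det(w, w') is a sum of two terms, each the product of positive
    speeds with the height by which one end of the chord exceeds the other in
    its own normal direction. So the angle B of w increases. Its increase over
    PI is an odd multiple of PI because w changes sign, positive by monotonicity
    and less than 3 PI because B(al) - al has oscillation less than 2 PI;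
    so it is PI. The function be is the inverse of B. *)
Lemma image_chord_angle C p r1 r2 f : centred_parametrization C p r1 r2 ->
  Cinf f ->
  (forall al, exists m, 0 < m /\ (r1 (f al), r2 (f al)) = pscal m (nvec al)) ->
  (forall al, exists k, 0 < k /\ is_derive f al k) ->
  (forall al be, (al - f al) - (be - f be) < PI) ->
  exists B be, Cinf be /\
    (forall al, be (B al) = al) /\
    (forall x, be (x + PI) = be x + PI) /\
    (forall x, exists m, 0 < m /\
       psub (r1 (f (be x) + PI), r2 (f (be x) + PI))
            (r1 (f (be x + PI) + PI), r2 (f (be x + PI) + PI))
       = pscal m (nvec x)).
Proof.
  intros CP Hf Rf Df Of.
  assert (H1 := cp_smooth1 _ _ _ _ CP). assert (H2 := cp_smooth2 _ _ _ _ CP).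
  set (w1 := fun al => r1 (f al + PI) - r1 (f (al + PI) + PI)).
  set (w2 := fun al => r2 (f al + PI) - r2 (f (al + PI) + PI)).
  assert (Hw1 : Cinf w1) by (unfold w1; smooth_tac).
  assert (Hw2 : Cinf w2) by (unfold w2; smooth_tac).
  assert (N : forall al, (r1 (f al + PI), r2 (f al + PI))
                    <> (r1 (f (al + PI) + PI), r2 (f (al + PI) + PI))).
  { intros al E. apply (same_point_same_normal _ _ _ _ CP) in E.
    rewrite !nvec_opposite in E. apply (opposite_ends _ _ _ _ _ CP Rf al).
    unfold pscal, nvec in *. simpl in E. injection E as E1 E2. f_equal; lra. }
  assert (Wa : forall al, 0 < dot (nvec (f al + PI)) (w1 al, w2 al)).
  { intros al. assert (N' := N al). apply not_eq_sym in N'.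
    apply (cp_support _ _ _ _ CP) in N'.
    unfold dot, w1, w2 in *. simpl in *. lra. }
  assert (Wb : forall al, dot (nvec (f (al + PI) + PI)) (w1 al, w2 al) < 0).
  { intros al. assert (N' := N al).
    apply (cp_support _ _ _ _ CP) in N'.
    unfold dot, w1, w2 in *. simpl in *. lra. }
  assert (Pos : forall t, 0 < w1 t * w1 t + w2 t * w2 t).
  { intros t. apply (nonzero_of_dot (nvec (f t + PI)) (w1 t, w2 t)).
    apply Rgt_not_eq, Wa. }
  destruct (smooth_polar_angle w1 w2 Hw1 Hw2 Pos) as [B [HB [DB EB]]].
  assert (PB : forall t, 0 < Derive B t).
  { intros t. rewrite DB. apply Rdiv_lt_0_compat; auto.
    destruct (Df t) as [k [Hk Dk]]. destruct (Df (t + PI)) as [k' [Hk' Dk']].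
    destruct (cp_velocity _ _ _ _ CP (f t + PI)) as [rho [Hr [D1 D2]]].
    destruct (cp_velocity _ _ _ _ CP (f (t + PI) + PI)) as [rho' [Hr' [D1' D2']]].
    assert (X1 : ex_derive r1 (f t + PI)) by now apply Cinf_ex_derive.
    assert (X2 : ex_derive r2 (f t + PI)) by now apply Cinf_ex_derive.
    assert (X3 : ex_derive r1 (f (t + PI) + PI)) by now apply Cinf_ex_derive.
    assert (X4 : ex_derive r2 (f (t + PI) + PI)) by now apply Cinf_ex_derive.
    assert (X5 : ex_derive f t) by now apply Cinf_ex_derive.
    assert (X6 : ex_derive f (t + PI)) by now apply Cinf_ex_derive.
    assert (E1 : Derive w1 t = k * (- rho * sin (f t + PI))
                  - k' * (- rho' * sin (f (t + PI) + PI))).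
    { apply is_derive_unique. unfold w1. auto_derive; auto 10.
      change (Derive (fun x => f x)) with (Derive f).
      change (Derive (fun x => r1 x)) with (Derive r1).
      rewrite (is_derive_unique _ _ _ D1), (is_derive_unique _ _ _ D1'),
        (is_derive_unique _ _ _ Dk), (is_derive_unique _ _ _ Dk'). ring. }
    assert (E2 : Derive w2 t = k * (rho * cos (f t + PI))
                  - k' * (rho' * cos (f (t + PI) + PI))).
    { apply is_derive_unique. unfold w2. auto_derive; auto 10.
      change (Derive (fun x => f x)) with (Derive f).
      change (Derive (fun x => r2 x)) with (Derive r2).
      rewrite (is_derive_unique _ _ _ D2), (is_derive_unique _ _ _ D2'),
        (is_derive_unique _ _ _ Dk), (is_derive_unique _ _ _ Dk'). ring. }
    rewrite E1, E2.
    apply Rlt_le_trans with (k * rho * dot (nvec (f t + PI)) (w1 t, w2 t)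
       + k' * rho' * (- dot (nvec (f (t + PI) + PI)) (w1 t, w2 t))).
    - apply Rplus_lt_0_compat; repeat apply Rmult_lt_0_compat; auto.
      specialize (Wb t). lra.
    - right. unfold dot, nvec. simpl. ring. }
  assert (Osc : forall x y, (B x - x) - (B y - y) < 2 * PI).
  { assert (O : forall x y, (B x - f x) - (B y - f y) < PI).
    { intros x y.
      replace (B x - f x - (B y - f y))
        with ((B x - (f x + PI)) - (B y - (f y + PI))) by ring.
      apply (oscillation_lt_PI (fun x => B x - (f x + PI))).
      - apply (Ck_continuous 0). smooth_tac.
      - intros t. assert (W := Wa t).
        destruct (EB t) as [m [Hm [E1 E2]]].
        assert (E : (w1 t, w2 t) = pscal m (nvec (B t))) by (rewrite E1, E2; auto).
        rewrite E, dot_pscal_nvec in W.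
        replace (cos (B t - (f t + PI))) with (cos (f t + PI - B t)).
        + nra.
        + rewrite <- cos_neg. f_equal. ring. }
    intros x y. assert (O1 := O x y). assert (O2 := Of y x). lra. }
  assert (IncB : forall x y, x < y -> B x < B y).
  { apply increasing_of_derive_pos with (Derive B); auto.
    intros; now apply Cinf_is_derive. }
  assert (w_anti : forall al, w1 (al + PI) = - w1 al /\ w2 (al + PI) = - w2 al).
  { intros al.
    assert (E : (r1 (f (al + PI + PI) + PI), r2 (f (al + PI + PI) + PI))
              = (r1 (f al + PI), r2 (f al + PI))).
    { apply (same_normal_same_point _ _ _ _ CP), nvec_eq_opposite.
      apply (same_point_same_normal _ _ _ _ CP).
      destruct (Rf al) as [m [Hm Em]]. destruct (Rf (al + PI + PI)) as [m' [Hm' Em']].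
      apply (same_ray_same_point _ _ _ _ CP) with (m' / m).
      - now apply Rdiv_lt_0_compat.
      - rewrite Em, Em', !nvec_opposite. unfold pscal. simpl. f_equal; field; lra. }
    injection E as E1 E2. unfold w1, w2. rewrite E1, E2. split; ring. }
  assert (B_anti : forall al, B (al + PI) = B al + PI).
  { intros al.
    assert (PI0 := PI_RGT_0).
    assert (O1 := Osc (al + PI) al). assert (I := IncB al (al + PI) ltac:(lra)).
    destruct (EB al) as [m [Hm [E1 E2]]].
    destruct (EB (al + PI)) as [m' [Hm' [E1' E2']]].
    destruct (w_anti al) as [W1 W2].
    rewrite W1, E1 in E1'. rewrite W2, E2 in E2'.
    assert (X := cos_sin_1 (B al)).
    assert (S : sin (B (al + PI) - B al) = 0).
    { apply (Rmult_eq_reg_l m'); [|lra]. rewrite sin_minus.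
      transitivity (m' * sin (B (al + PI)) * cos (B al)
        - m' * cos (B (al + PI)) * sin (B al)); [ring|].
      rewrite <- E1', <- E2'. ring. }
    assert (K : cos (B (al + PI) - B al) < 0).
    { apply (Rmult_lt_reg_l m'); auto. rewrite cos_minus, Rmult_0_r.
      apply Rle_lt_trans with
        (- m * (cos (B al) * cos (B al) + sin (B al) * sin (B al))); [|rewrite X; lra].
      right. transitivity (m' * cos (B (al + PI)) * cos (B al)
        + m' * sin (B (al + PI)) * sin (B al)); [ring|].
      rewrite <- E1', <- E2'. ring. }
    set (x := B (al + PI) - B al) in *.
    enough (x = PI) by (unfold x in *; lra).
    assert (0 < x < 3 * PI) by (unfold x; lra). clearbody x.
    destruct (Rle_lt_dec x (2 * PI)) as [L|L].
    - destruct (sin_eq_O_2PI_0 x) as [Z|[Z|Z]]; auto; try lra.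
      rewrite Z, cos_2PI in K. lra.
    - assert (0 < sin (x - 2 * PI)) by (apply sin_gt_0; lra).
      replace (x - 2 * PI) with (- (2 * PI - x)) in H0 by ring.
      rewrite sin_neg, sin_minus, sin_2PI, cos_2PI, S in H0. lra. }
  destruct (smooth_inverse B HB PB) as [be [Hbe [beB [Bbe _]]]].
  { intros v. exists (v - B 0 - 2 * PI), (v - B 0 + 2 * PI).
    assert (O1 := Osc (v - B 0 - 2 * PI) 0).
    assert (O2 := Osc 0 (v - B 0 + 2 * PI)). lra. }
  exists B, be. split; [exact Hbe|]. split; [exact beB|]. split.
  - intros x. rewrite <- (Bbe x) at 1. rewrite <- B_anti. apply beB.
  - intros x. destruct (EB (be x)) as [m [Hm [E1 E2]]]. exists m. split; auto.
    rewrite Bbe in E1, E2. unfold pscal, psub, nvec. simpl.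
    unfold w1, w2 in E1, E2. now rewrite E1, E2.
Qed.

(** The image line with normal angle t has direction angle x = t + PI / 2, so it
    comes from the chord of direction be(x). Another chord with an image of the
    same normal differs from it by a multiple of PI in direction, and has the
    same image line because the offset q0 is antiperiodic. *)
Lemma offset_smooth C p : is_oval C -> int_region C p ->
  Cinf (offset C p) /\ forall t, offset C p (t + PI) = - offset C p t.
Proof.
  intros HC Hp. destruct (oval_centred_parametrization C p HC Hp) as [r1 [r2 CP]].
  destruct (polar_inverse _ _ _ _ CP) as [A [f [Hf [fA [RA [Rf [Df Of]]]]]]].
  destruct (image_chord_angle _ _ _ _ f CP Hf Rf Df Of)
    as [B [be [Hbe [beB [be_anti W]]]]].
  set (r := fun phi => (r1 phi, r2 phi) : plane).
  set (q0 := fun t => dot (nvec t)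
     (r1 (f (be (t + PI / 2)) + PI), r2 (f (be (t + PI / 2)) + PI))).
  assert (H1 := cp_smooth1 _ _ _ _ CP). assert (H2 := cp_smooth2 _ _ _ _ CP).
  assert (Hq0 : Cinf q0).
  { unfold q0, dot, nvec. cbn [fst snd]. smooth_tac. }
  (* n(t) is orthogonal to the image chord, so either end of the chord computes the offset *)
  assert (q0_alt : forall t, q0 t = dot (nvec t)
     (r (f (be (t + PI / 2) + PI) + PI))).
  { intros t. destruct (W (t + PI / 2)) as [m [Hm E]].
    apply (f_equal (dot (nvec t))) in E. rewrite dot_pscal_nvec in E.
    replace (t - (t + PI / 2)) with (- (PI / 2)) in E by ring.
    rewrite cos_neg, cos_PI2 in E. unfold q0, r.
    unfold dot, psub in *. simpl in *. lra. }
  assert (q0_anti : forall t, q0 (t + PI) = - q0 t).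
  { intros t. rewrite (q0_alt t). unfold q0.
    replace (t + PI + PI / 2) with (t + PI / 2 + PI) by ring.
    rewrite be_anti, nvec_opposite. unfold r, dot, pscal. simpl. ring. }
  assert (q0_per : forall t, q0 (t + 2 * PI) = q0 t).
  { intros t. replace (t + 2 * PI) with (t + PI + PI) by ring.
    rewrite !q0_anti. ring. }
  assert (Uniq : forall t s, Phi_pencil C p (normal_line p t s) -> s = q0 t).
  { intros t s [L [[_ Lp] [x [y [x' [y' [Cx [Cy [Nxy [HL [Ax [Ay HM]]]]]]]]]]]].
    apply (antipode_iff _ _ _ _ CP) in Ax. destruct Ax as [phi [-> ->]].
    apply (antipode_iff _ _ _ _ CP) in Ay. destruct Ay as [psi [-> ->]].
    apply HL in Lp.
    assert (Px : normal_line p t s (padd p (r1 (phi + PI), r2 (phi + PI)))).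
    { apply HM. unfold line_through, det, psub. simpl. ring. }
    assert (Py : normal_line p t s (padd p (r1 (psi + PI), r2 (psi + PI)))).
    { apply HM. unfold line_through, det, psub. simpl. ring. }
    assert (Ex : dot (nvec t) (r (phi + PI)) = s).
    { rewrite <- Px. unfold dot, psub, padd. simpl. ring. }
    assert (Ey : dot (nvec t) (r (psi + PI)) = s).
    { rewrite <- Py. unfold dot, psub, padd. simpl. ring. }
    assert (Nr : (r1 psi, r2 psi) <> (r1 phi, r2 phi)).
    { intros E. apply Nxy. now rewrite E. }
    assert (Col : det (r phi) (r psi) = 0).
    { apply Ropp_eq_reg. rewrite Ropp_0, <- Lp.
      unfold line_through, det, psub, padd. simpl. ring. }
    destruct (RA phi) as [m [Hm Em]]. destruct (RA psi) as [m' [Hm' Em']].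
    assert (S : sin (A psi - A phi) = 0).
    { apply (Rmult_eq_reg_l (m * m')); [|nra].
      rewrite Rmult_0_r, <- Col. unfold r. rewrite Em, Em', sin_minus.
      unfold det, pscal, nvec. simpl. ring. }
    assert (Opp : nvec (A psi) = nvec (A phi + PI)).
    { destruct (nvec_parallel _ _ S) as [E|E]; auto. destruct Nr.
      apply (same_ray_same_point _ _ _ _ CP) with (m' / m).
      - now apply Rdiv_lt_0_compat.
      - rewrite Em, Em', E. unfold pscal. simpl. f_equal; field; lra. }
    set (al := A phi) in *.
    (* the second end of any chord through p is the point on the opposite ray *)
    assert (Npsi : nvec (psi + PI) = nvec (f (al + PI) + PI)).
    { apply nvec_eq_opposite, (same_point_same_normal _ _ _ _ CP).
      destruct (Rf (al + PI)) as [m2 [Hm2 Em2]].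
      apply (same_ray_same_point _ _ _ _ CP) with (m' / m2).
      - now apply Rdiv_lt_0_compat.
      - rewrite Em', Em2, Opp. unfold pscal. simpl. f_equal; field; lra. }
    apply (same_normal_same_point _ _ _ _ CP) in Npsi.
    unfold r in Ey. rewrite Npsi in Ey.
    replace phi with (f al) in Ex by apply fA.
    assert (Wal := W (B al)). rewrite beB in Wal. destruct Wal as [k [Hk Ek]].
    apply (f_equal (dot (nvec t))) in Ek. rewrite dot_pscal_nvec in Ek.
    assert (K : cos (t - B al) = 0).
    { apply (Rmult_eq_reg_l k); [|lra]. rewrite Rmult_0_r, <- Ek.
      unfold r in Ex. unfold dot, psub in *. simpl in *. lra. }
    assert (Qa : q0 (B al - PI / 2) = dot (nvec (B al - PI / 2)) (r (f al + PI))).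
    { unfold q0. replace (B al - PI / 2 + PI / 2) with (B al) by ring.
      now rewrite beB. }
    assert (S' : sin (t - (B al - PI / 2)) = 0).
    { replace (t - (B al - PI / 2)) with (PI / 2 + (t - B al)) by ring.
      now rewrite <- cos_sin. }
    destruct (nvec_parallel _ _ S') as [E|E].
    - rewrite (periodic_nvec q0 q0_per _ _ E), Qa, <- E. auto.
    - rewrite (periodic_nvec q0 q0_per _ _ E), q0_anti, Qa, <- Ex, E, nvec_opposite.
      unfold dot, pscal. simpl. ring. }
  assert (Ex : forall t, Phi_pencil C p (normal_line p t (q0 t))).
  { intros t. set (al := be (t + PI / 2)).
    set (a := f al). set (b := f (al + PI)).
    destruct (Rf al) as [m [Hm Em]]. destruct (Rf (al + PI)) as [m' [Hm' Em']].
    fold a in Em. fold b in Em'.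
    assert (Nab : padd p (r1 a, r2 a) <> padd p (r1 b, r2 b)).
    { intros E. apply (opposite_ends _ _ _ _ _ CP Rf al).
      apply (same_point_same_normal _ _ _ _ CP).
      unfold padd in E. injection E as E1 E2.
      apply Rplus_eq_reg_l in E1. apply Rplus_eq_reg_l in E2.
      fold a b. now rewrite E1, E2. }
    exists (line_through (padd p (r1 a, r2 a)) (padd p (r1 b, r2 b))). split.
    - split.
      + exists (padd p (r1 a, r2 a)), (padd p (r1 b, r2 b)). split; auto. reflexivity.
      + unfold line_through. rewrite Em, Em', nvec_opposite.
        unfold det, psub, padd, pscal. simpl. ring.
    - exists (padd p (r1 a, r2 a)), (padd p (r1 b, r2 b)),
        (padd p (r1 (a + PI), r2 (a + PI))), (padd p (r1 (b + PI), r2 (b + PI))).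
      split; [apply (cp_image _ _ _ _ CP); now exists a|].
      split; [apply (cp_image _ _ _ _ CP); now exists b|].
      split; [exact Nab|]. split; [reflexivity|].
      split; [apply (antipode_iff _ _ _ _ CP); now exists a|].
      split; [apply (antipode_iff _ _ _ _ CP); now exists b|].
      intros P. unfold line_through, normal_line.
      destruct (W (t + PI / 2)) as [k [Hk Ek]]. fold al a b in Ek.
      assert (D : det (psub P (padd p (r1 (a + PI), r2 (a + PI))))
        (psub (padd p (r1 (b + PI), r2 (b + PI))) (padd p (r1 (a + PI), r2 (a + PI))))
        = - k * (dot (nvec t) (psub P p) - q0 t)).
      { transitivity (- det (psub P (padd p (r1 (a + PI), r2 (a + PI))))
          (psub (r1 (a + PI), r2 (a + PI)) (r1 (b + PI), r2 (b + PI)))).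
        - unfold det, psub, padd. simpl. ring.
        - rewrite Ek. unfold q0. fold al a.
          replace (nvec (t + PI / 2)) with (tvec t).
          2: { unfold nvec, tvec. rewrite Rplus_comm, <- cos_sin, (sin_cos t).
               f_equal. ring. }
          unfold det, dot, psub, padd, pscal, nvec, tvec. simpl. ring. }
      rewrite D. split; intros E.
      + rewrite E. ring.
      + apply (Rmult_eq_reg_l (- k)); [|lra]. lra. }
  assert (Eq : forall t, offset C p t = q0 t).
  { intros t. unfold offset.
    apply (iota_unique (V := R_CompleteNormedModule)); auto. }
  split.
  - intros n. apply Ck_ext with q0; auto.
  - intros t. now rewrite !Eq.
Qed.

(** * Antiperiodic functions and the area of an envelope *)

(** Integrals are typed in the carrier of a normed module; [ring] has to see
    the reals. *)
Ltac as_real := match goal with |- @eq _ ?a ?b => refine (_ : @eq R a b) end.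

Definition antiperiodic (f : R -> R) : Prop := forall t, f (t + PI) = - f t.

Lemma ex_RInt_Cinf (f : R -> R) a b : Cinf f -> ex_RInt f a b.
Proof.
  intros H. apply (ex_RInt_continuous (V := R_CompleteNormedModule)).
  intros; now apply Cinf_continuous.
Qed.

Lemma RInt_Cinf_plus f h a b : Cinf f -> Cinf h ->
  RInt (fun t => f t + h t) a b = RInt f a b + RInt h a b.
Proof. intros Hf Hh. apply (RInt_plus f h); now apply ex_RInt_Cinf. Qed.

Lemma RInt_Cinf_scal k f a b : Cinf f ->
  RInt (fun t => k * f t) a b = k * RInt f a b.
Proof. intros Hf. apply (RInt_scal f); now apply ex_RInt_Cinf. Qed.

Lemma antiperiodic_Derive f : Cinf f -> antiperiodic f -> antiperiodic (Derive f).
Proof.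
  intros H A t.
  assert (E : is_derive (fun s => f (s + PI)) t (Derive f (t + PI))).
  { assert (X : ex_derive f (t + PI)) by now apply Cinf_ex_derive.
    auto_derive; auto.
    change (Derive (fun x => f x) (t + PI)) with (Derive f (t + PI)). ring. }
  rewrite <- (is_derive_unique _ _ _ E).
  rewrite (Derive_ext _ (fun s => - f s)) by (intros; apply A).
  apply (Derive_opp f).
Qed.

Lemma RInt_Derive_Cinf f a b : Cinf f -> RInt (Derive f) a b = f b - f a.
Proof.
  intros H. apply (is_RInt_unique (Derive f)).
  apply (is_RInt_derive f (Derive f)); intros t _.
  - now apply Cinf_is_derive.
  - now apply Cinf_continuous, Cinf_Derive.
Qed.

(** The product u v is PI-periodic, so the boundary terms cancel. *)
Lemma antiperiodic_by_parts u v : Cinf u -> Cinf v -> antiperiodic u -> antiperiodic v ->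
  RInt (fun t => Derive u t * v t) 0 PI = - RInt (fun t => u t * Derive v t) 0 PI.
Proof.
  intros Hu Hv Au Av.
  assert (E : RInt (Derive (fun t => u t * v t)) 0 PI = 0).
  { rewrite RInt_Derive_Cinf by smooth_tac.
    specialize (Au 0). specialize (Av 0). rewrite Rplus_0_l in Au, Av.
    rewrite Au, Av. as_real. ring. }
  rewrite (RInt_ext _ (fun t => Derive u t * v t + u t * Derive v t)) in E.
  - rewrite (RInt_Cinf_plus (fun t => Derive u t * v t) (fun t => u t * Derive v t))
      in E by smooth_tac. lra.
  - intros t _. apply Derive_mult; now apply Cinf_ex_derive.
Qed.

Lemma antiperiodic_green u v : Cinf u -> Cinf v -> antiperiodic u -> antiperiodic v ->
  RInt (fun t => Derive (Derive u) t * v t) 0 PI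
  = RInt (fun t => u t * Derive (Derive v) t) 0 PI.
Proof.
  intros Hu Hv Au Av.
  rewrite (antiperiodic_by_parts (Derive u) v); auto using Cinf_Derive, antiperiodic_Derive.
  rewrite (antiperiodic_by_parts u (Derive v)); auto using Cinf_Derive, antiperiodic_Derive.
  as_real. ring.
Qed.

Lemma is_derive_primitive f t : Cinf f -> is_derive (fun x => RInt f 0 x) t (f t).
Proof. intros H. apply is_derive_integral. intros; now apply Cinf_continuous. Qed.

Lemma primitive_shift f : Cinf f -> (forall t, f (t + PI) = f t) ->
  forall t, RInt f 0 (t + PI) = RInt f 0 t + RInt f 0 PI.
Proof.
  intros H P t. set (J := fun x => RInt f 0 x : R).
  assert (D : forall x, is_derive J x (f x)) by (intros; now apply is_derive_primitive).
  assert (K : J (t + PI) - J t = J (0 + PI) - J 0).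
  { apply (constant_of_derive0 (fun t => J (t + PI) - J t)). intros s.
    assert (X1 : ex_derive J s) by now exists (f s).
    assert (X2 : ex_derive J (s + PI)) by now exists (f (s + PI)).
    auto_derive; auto.
    change (Derive (fun x => J x)) with (Derive J).
    rewrite (is_derive_unique _ _ _ (D s)), (is_derive_unique _ _ _ (D (s + PI))), P.
    ring. }
  assert (J0 : J 0 = 0) by apply (RInt_point 0 f).
  rewrite Rplus_0_l in K. unfold J in *. lra.
Qed.

Lemma nondecreasing_of_derive f f' x y :
  (forall t, x <= t <= y -> is_derive f t (f' t)) ->
  (forall t, x <= t <= y -> 0 <= f' t) -> x <= y -> f x <= f y.
Proof.
  intros D P L.
  destruct (MVT_gen f x y f') as [z [Hz E]];
    rewrite ?Rmin_left, ?Rmax_right in * by lra.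
  - intros t Ht. apply D. lra.
  - intros t Ht. apply continuity_pt_filterlim. apply (ex_derive_continuous f).
    exists (f' t). now apply D.
  - specialize (P z Hz). nra.
Qed.

(** The primitive of f is nondecreasing and PI-periodic, hence constant. *)
Lemma zero_of_RInt_periodic f : Cinf f -> (forall t, f (t + PI) = f t) ->
  (forall t, 0 <= f t) -> RInt f 0 PI = 0 -> forall t, f t = 0.
Proof.
  intros H P N Z t. set (J := fun x => RInt f 0 x : R).
  assert (D : forall x, is_derive J x (f x)) by (intros; now apply is_derive_primitive).
  assert (Mono : forall x y, x <= y -> J x <= J y).
  { intros x y. apply nondecreasing_of_derive with f; auto. }
  assert (J_per : forall x, J (x + PI) = J x).
  { intros x. unfold J. rewrite primitive_shift by auto. rewrite Z. as_real. ring. }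
  assert (Flat : forall x y, x <= y <= x + PI -> J y = J x).
  { intros x y L. assert (M1 := Mono x y ltac:(lra)).
    assert (M2 := Mono y (x + PI) ltac:(lra)). rewrite J_per in M2. lra. }
  rewrite <- (is_derive_unique _ _ _ (D t)).
  apply is_derive_unique. apply is_derive_ext_loc with (fun _ => J (t - 1)).
  - exists (mkposreal 1 Rlt_0_1). intros y Hy.
    change (Rabs (y - t) < 1) in Hy. apply Rabs_def2 in Hy.
    symmetry. apply Flat. generalize PI2_1. lra.
  - apply (is_derive_const (J (t - 1))).
Qed.

Lemma continuous_right_limit_ge0 (f : R -> R) d :
  continuous f 0 -> 0 < d -> (forall x, 0 < x < d -> 0 <= f x) -> 0 <= f 0.
Proof.
  intros Cf Hd P. destruct (Rle_lt_dec 0 (f 0)) as [L|L]; auto. exfalso.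
  destruct (continuous_eps f 0 Cf (- f 0) ltac:(lra)) as [e [He K]].
  assert (Hm : 0 < Rmin d e) by now apply Rmin_glb_lt.
  assert (M1 := Rmin_l d e). assert (M2 := Rmin_r d e).
  assert (K' := K (Rmin d e / 2)). rewrite Rminus_0_r, Rabs_pos_eq in K' by lra.
  assert (P' := P (Rmin d e / 2)).
  specialize (K' ltac:(lra)). specialize (P' ltac:(lra)).
  apply Rabs_def2 in K'. lra.
Qed.

Lemma half_le_sin x : 0 <= x <= 1 -> x / 2 <= sin x.
Proof.
  intros Hx.
  assert (S : sin 0 - 0 / 2 <= sin x - x / 2).
  { apply (nondecreasing_of_derive (fun x => sin x - x / 2) (fun x => cos x - 1 / 2)).
    - intros t _. auto_derive; auto. field.
    - intros t Ht. rewrite <- cos_PI3.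
      assert (cos (PI / 3) <= cos t); [|lra].
      apply cos_decr_1; generalize PI2_1 PI_RGT_0 (PI_4); try lra.
      intros. generalize PI2_3_2. lra.
    - lra. }
  rewrite sin_0 in S. lra.
Qed.

(** Antiperiodicity gives a zero t0 of q. On the open interval from t0 to t0 + PI
    the function H = J - q^2 cot(t - t0), with J a primitive of q'^2 - q^2, has
    the derivative (q' - q cot)^2 >= 0. Near both ends q vanishes to first order
    and the cotangent has a simple pole, so q^2 cot is O(x) at distance x, and
    the monotonicity of H passes to the limit. *)
Lemma wirtinger q : Cinf q -> antiperiodic q ->
  0 <= RInt (fun t => Derive q t ^ 2 - q t ^ 2) 0 PI.
Proof.
  intros Hq Aq. assert (PI0 := PI2_1).
  assert (Hq' := Cinf_Derive q Hq).
  assert (Z : exists t0, q t0 = 0).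
  { assert (E := Aq 0). rewrite Rplus_0_l in E.
    destruct (Rle_lt_dec (q 0) 0) as [L|L].
    - destruct (IVT_continuous q 0 PI 0) as [z [_ Hz]]; try lra.
      + intros; now apply Cinf_continuous.
      + now exists z.
    - destruct (IVT_continuous (fun t => - q t) 0 PI 0) as [z [_ Hz]]; try lra.
      + intros t. apply (continuous_opp q). now apply Cinf_continuous.
      + exists z. lra. }
  destruct Z as [t0 Hz].
  set (e := fun t => Derive q t ^ 2 - q t ^ 2).
  assert (He : Cinf e).
  { unfold e. smooth_tac. }
  set (J := fun x => RInt e 0 x : R).
  assert (DJ : forall x, is_derive J x (e x)) by (intros; now apply is_derive_primitive).
  assert (JP : J (t0 + PI) - J t0 = RInt e 0 PI).
  { unfold J. rewrite primitive_shift; auto; [as_real; ring|].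
    intros t. unfold e. rewrite Aq, antiperiodic_Derive by auto. ring. }
  set (L := fun t => q t ^ 2 * cos (t - t0) / sin (t - t0)).
  set (H := fun t => J t - L t).
  assert (Mono : forall x y, t0 < x -> x <= y -> y < t0 + PI -> H x <= H y).
  { intros x y Hx Hxy Hy.
    assert (S : forall t, x <= t <= y -> 0 < sin (t - t0)).
    { intros t Ht. apply sin_gt_0; lra. }
    apply nondecreasing_of_derive with
      (fun t => (Derive q t - q t * cos (t - t0) / sin (t - t0)) ^ 2); auto.
    - intros t Ht. specialize (S t Ht).
      replace ((Derive q t - q t * cos (t - t0) / sin (t - t0)) ^ 2)
        with (e t - (2 * q t * Derive q t * cos (t - t0) / sin (t - t0)
                     - q t ^ 2 / sin (t - t0) ^ 2)).
      + unfold H. apply (is_derive_minus J L); auto.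
        unfold L. assert (X : ex_derive q t) by now apply Cinf_ex_derive.
        auto_derive; [repeat split; auto; unfold Rminus in S; lra|].
        change (Derive (fun x => q x) t) with (Derive q t).
        assert (CS := cos_sin_1 (t - t0)). unfold Rminus in *.
        apply (Rmult_eq_reg_r (sin (t + - t0) ^ 2)); [|apply pow_nonzero; lra].
        field_simplify; try lra.
        assert (CS2 : sin (t + - t0) ^ 2 = 1 - cos (t + - t0) ^ 2) by (simpl; lra).
        simpl in *. nra.
      + unfold e. assert (CS := cos_sin_1 (t - t0)).
        assert (CS2 : cos (t - t0) ^ 2 = 1 - sin (t - t0) ^ 2) by (simpl; lra).
        transitivity (Derive q t ^ 2
          - 2 * q t * Derive q t * cos (t - t0) / sin (t - t0)
          + q t ^ 2 * cos (t - t0) ^ 2 / sin (t - t0) ^ 2); [rewrite CS2|]; field; lra.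
    - intros t Ht. apply pow2_ge_0. }
  assert (Bd : exists K, 0 <= K /\
     forall x, 0 <= x <= 1 -> Rabs (q (t0 + x)) <= K * x /\ Rabs (q (t0 - x)) <= K * x).
  { destruct (continuity_ab_maj (fun t => Rabs (Derive q t)) (t0 - 1) (t0 + 1))
      as [M [HM _]]; [lra| |].
    { intros c _. apply continuity_pt_filterlim.
      apply (continuous_comp (Derive q) Rabs); [now apply Cinf_continuous|].
      apply continuous_Rabs. }
    exists (Rabs (Derive q M)). split; [apply Rabs_pos|].
    assert (B : forall y, t0 - 1 <= y <= t0 + 1 ->
       Rabs (q y) <= Rabs (Derive q M) * Rabs (y - t0)).
    { intros y Hy. destruct (MVT_gen q t0 y (Derive q)) as [z [Hzz E]].
      - intros; now apply Cinf_is_derive.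
      - intros s _. now apply continuity_pt_filterlim, Cinf_continuous.
      - rewrite Hz, Rminus_0_r in E. rewrite E, Rabs_mult.
        apply Rmult_le_compat_r; [apply Rabs_pos|]. apply HM.
        revert Hzz. unfold Rmin, Rmax. destruct Rle_dec; lra. }
    intros x Hx. split.
    - replace x with (Rabs (t0 + x - t0)) at 2; [apply B; lra|].
      replace (t0 + x - t0) with x by ring. apply Rabs_pos_eq; lra.
    - replace x with (Rabs (t0 - x - t0)) at 2; [apply B; lra|].
      replace (t0 - x - t0) with (- x) by ring. rewrite Rabs_Ropp.
      apply Rabs_pos_eq; lra. }
  destruct Bd as [K [HK B]].
  assert (Sq : forall x y c s, 0 < x <= 1 -> Rabs y <= K * x -> Rabs c <= 1 ->
     x / 2 <= s -> Rabs (y ^ 2 * c / s) <= 2 * K ^ 2 * x).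
  { intros x y c s Hx Hy Hc Hs.
    unfold Rdiv. rewrite !Rabs_mult, Rabs_inv, (Rabs_pos_eq s), <- RPow_abs by lra.
    apply (Rmult_le_reg_r s); [lra|].
    rewrite Rmult_assoc, Rinv_l, Rmult_1_r by lra.
    assert (P1 := Rabs_pos y). assert (P2 := Rabs_pos c).
    assert (Rabs y ^ 2 <= (K * x) ^ 2) by (apply pow_incr; lra).
    assert (Rabs y ^ 2 * Rabs c <= (K * x) ^ 2 * 1).
    { apply Rmult_le_compat; auto. apply pow2_ge_0. }
    assert ((K * x) ^ 2 <= 2 * K ^ 2 * x * s).
    { replace ((K * x) ^ 2) with (2 * K ^ 2 * x * (x / 2)) by field.
      apply Rmult_le_compat_l; auto.
      apply Rmult_le_pos; [|lra]. apply Rmult_le_pos; [lra|apply pow2_ge_0]. }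
    lra. }
  assert (Cb : forall t, Rabs (cos t) <= 1).
  { intros t. apply Rabs_le. apply COS_bound. }
  (* each end contributes an error of at most 2 K^2 x *)
  set (k := fun x => J (t0 + PI - x) - J (t0 + x) + 4 * K ^ 2 * x).
  assert (Kpos : 0 <= k 0).
  { apply (continuous_right_limit_ge0 k 1); [|lra|].
    - apply (ex_derive_continuous k). unfold k.
      assert (X1 : ex_derive J (t0 + PI - 0)) by (eexists; apply DJ).
      assert (X2 : ex_derive J (t0 + 0)) by (eexists; apply DJ).
      auto_derive; auto.
    - intros x Hx.
      assert (M := Mono (t0 + x) (t0 + PI - x) ltac:(lra) ltac:(lra) ltac:(lra)).
      destruct (B x ltac:(lra)) as [B1 B2].
      assert (S := half_le_sin x ltac:(lra)).
      assert (L1 : Rabs (L (t0 + x)) <= 2 * K ^ 2 * x).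
      { unfold L. replace (t0 + x - t0) with x by ring. apply Sq; auto. lra. }
      assert (L2 : Rabs (L (t0 + PI - x)) <= 2 * K ^ 2 * x).
      { unfold L. replace (t0 + PI - x - t0) with (PI - x) by ring.
        rewrite sin_PI_x. apply Sq; auto; [lra|].
        replace (t0 + PI - x) with (t0 - x + PI) by ring.
        now rewrite Aq, Rabs_Ropp. }
      apply Rabs_le_between in L1. apply Rabs_le_between in L2.
      unfold H in M. unfold k. lra. }
  unfold k in Kpos. rewrite Rminus_0_r, Rplus_0_r, Rmult_0_r, Rplus_0_r in Kpos.
  fold e. apply Rle_trans with (1 := Kpos). right. exact JP.
Qed.

Lemma RInt_energy q : Cinf q -> antiperiodic q ->
  RInt (fun t => Derive q t ^ 2 - q t ^ 2) 0 PI
  = - RInt (fun t => (q t + Derive (Derive q) t) * q t) 0 PI.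
Proof.
  intros Hq Aq. assert (Hq' := Cinf_Derive q Hq). assert (Hq'' := Cinf_Derive _ Hq').
  assert (E1 : RInt (fun t => Derive q t ^ 2 - q t ^ 2) 0 PI
    = RInt (fun t => Derive q t * Derive q t) 0 PI
      + -1 * RInt (fun t => q t * q t) 0 PI).
  { rewrite <- RInt_Cinf_scal, <- RInt_Cinf_plus by smooth_tac.
    apply RInt_ext. intros. as_real. ring. }
  assert (E2 : RInt (fun t => (q t + Derive (Derive q) t) * q t) 0 PI
    = RInt (fun t => q t * q t) 0 PI + RInt (fun t => Derive (Derive q) t * q t) 0 PI).
  { rewrite <- RInt_Cinf_plus by smooth_tac. apply RInt_ext. intros. as_real. ring. }
  rewrite E1, E2, (antiperiodic_by_parts (Derive q) q)
    by (auto using antiperiodic_Derive).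
  as_real. ring.
Qed.

(** A minimizer q of the nonnegative functional is stationary. Varying it in the
    direction h = q + q'', the first-order term is - 2 eps times the integral of
    h^2, which must vanish. *)
Lemma wirtinger_equality q : Cinf q -> antiperiodic q ->
  RInt (fun t => Derive q t ^ 2 - q t ^ 2) 0 PI = 0 ->
  forall t, q t + Derive (Derive q) t = 0.
Proof.
  intros Hq Aq Z. assert (Hq' := Cinf_Derive q Hq). assert (Hq'' := Cinf_Derive _ Hq').
  set (h := fun t => q t + Derive (Derive q) t).
  assert (Hh : Cinf h) by (unfold h; smooth_tac).
  assert (Ah : antiperiodic h).
  { intros t. unfold h. rewrite Aq, !antiperiodic_Derive; auto using antiperiodic_Derive.
    ring. }
  assert (Hh' := Cinf_Derive h Hh).
  set (N := RInt (fun t => h t * h t) 0 PI : R).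
  set (M := RInt (fun t => Derive h t ^ 2 - h t ^ 2) 0 PI : R).
  assert (Quad : forall eps, 0 <= - (2 * eps * N) + eps ^ 2 * M).
  { intros eps.
    assert (W := wirtinger (fun t => q t + eps * h t)).
    assert (Hs : Cinf (fun t => q t + eps * h t)) by smooth_tac.
    assert (D : forall t, Derive (fun t => q t + eps * h t) t
                          = Derive q t + eps * Derive h t).
    { intros t. apply is_derive_unique.
      assert (X1 : ex_derive q t) by now apply Cinf_ex_derive.
      assert (X2 : ex_derive h t) by now apply Cinf_ex_derive.
      auto_derive; auto.
      change (Derive (fun x => q x) t) with (Derive q t).
      change (Derive (fun x => h x) t) with (Derive h t). ring. }
    specialize (W Hs). eapply Rle_trans.
    - apply W. intros t. rewrite Aq, Ah. ring.
    - right.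
      assert (B : RInt (fun t => Derive h t * Derive q t) 0 PI
                  = - RInt (fun t => h t * Derive (Derive q) t) 0 PI).
      { apply (antiperiodic_by_parts h (Derive q)); auto.
        now apply antiperiodic_Derive. }
      transitivity (RInt (fun t => Derive q t ^ 2 - q t ^ 2) 0 PI
        + 2 * eps * (RInt (fun t => Derive h t * Derive q t) 0 PI
                     + -1 * RInt (fun t => h t * q t) 0 PI) + eps ^ 2 * M).
      + unfold M. rewrite <- !RInt_Cinf_scal by smooth_tac.
        rewrite <- RInt_Cinf_plus by smooth_tac.
        rewrite <- !RInt_Cinf_scal by smooth_tac.
        rewrite <- !RInt_Cinf_plus by smooth_tac.
        apply RInt_ext. intros t _. rewrite D. as_real. ring.
      + rewrite Z, B.
        assert (EN : N = RInt (fun t => h t * q t) 0 PI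
                         + RInt (fun t => h t * Derive (Derive q) t) 0 PI).
        { rewrite <- RInt_Cinf_plus by smooth_tac.
          apply RInt_ext. intros t _. unfold h. as_real. ring. }
        rewrite EN. as_real. ring. }
  assert (N0 : 0 <= N).
  { apply RInt_ge_0; [generalize PI_RGT_0; lra| |].
    - apply (ex_RInt_Cinf (fun t => h t * h t)). smooth_tac.
    - intros t _. apply (Rle_0_sqr (h t)). }
  assert (NZ : N = 0).
  { destruct N0 as [L|L]; auto. exfalso.
    set (d := 1 + Rabs M). assert (Hd : 1 <= d) by (unfold d; generalize (Rabs_pos M); lra).
    (* a step small enough for the linear term to dominate the quadratic one *)
    assert (Q := Quad (N / d)).
    assert (X : (N / d) ^ 2 * M <= (N / d) * N).
    { replace ((N / d) ^ 2 * M) with ((N / d) * N * (M / d)) by (field; lra).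
      assert (0 < N / d) by (apply Rdiv_lt_0_compat; lra).
      assert (M / d <= 1).
      { apply (Rmult_le_reg_r d); [lra|]. unfold Rdiv.
        rewrite Rmult_assoc, Rinv_l by lra. unfold d. generalize (Rle_abs M). lra. }
      assert (0 < N / d * N) by now apply Rmult_lt_0_compat. nra. }
    assert (0 < N / d * N).
    { apply Rmult_lt_0_compat; auto. apply Rdiv_lt_0_compat; lra. }
    lra. }
  intros t. fold (h t).
  assert (T := zero_of_RInt_periodic (fun t => h t * h t) ltac:(smooth_tac)).
  assert (h t * h t = 0); [|nra].
  apply T; auto.
  - intros s. rewrite Ah. ring.
  - intros s. apply (Rle_0_sqr (h s)).
Qed.

Lemma envelope_velocity p q t : Cinf q ->
  velocity (envelope p q) t = pscal (q t + Derive (Derive q) t) (tvec t).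
Proof.
  intros Hq.
  assert (X1 : ex_derive q t) by now apply Cinf_ex_derive.
  assert (X2 : ex_derive (Derive q) t) by now apply Cinf_ex_derive, Cinf_Derive.
  unfold velocity, envelope, padd, pscal, nvec, tvec. cbn [fst snd]. f_equal.
  - apply is_derive_unique. auto_derive; auto.
    change (Derive (fun x => q x) t) with (Derive q t).
    change (Derive (fun x => Derive (fun y => q y) x) t) with (Derive (Derive q) t).
    change (Derive (fun x => Derive q x) t) with (Derive (Derive q) t). ring.
  - apply is_derive_unique. auto_derive; auto.
    change (Derive (fun x => q x) t) with (Derive q t).
    change (Derive (fun x => Derive q x) t) with (Derive (Derive q) t). ring.
Qed.

(** det(X, X') = (q + q'') (q + p . n), and p . n satisfies s + s'' = 0, so by
    Green's formula it does not contribute: the area does not depend on the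
    base point. *)
Lemma envelope_area_second_order p q : Cinf q -> antiperiodic q ->
  oriented_area (envelope p q) 0 PI
  = / 2 * RInt (fun t => (q t + Derive (Derive q) t) * q t) 0 PI.
Proof.
  intros Hq Aq. assert (Hq' := Cinf_Derive q Hq). assert (Hq'' := Cinf_Derive _ Hq').
  unfold oriented_area. f_equal.
  set (s := fun t => fst p * cos t + snd p * sin t).
  assert (Hs : Cinf s) by (unfold s; smooth_tac).
  assert (As : antiperiodic s).
  { intros t. unfold s. rewrite neg_cos, neg_sin. ring. }
  assert (Ds : forall t, Derive (Derive s) t = - s t).
  { intros t.
    rewrite (Derive_ext _ (fun t => - fst p * sin t + snd p * cos t)).
    - apply is_derive_unique. unfold s. auto_derive; auto. ring.
    - intros u. apply is_derive_unique. unfold s. auto_derive; auto. ring. }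
  assert (Z : RInt (fun t => q t * s t) 0 PI
              + RInt (fun t => Derive (Derive q) t * s t) 0 PI = 0).
  { rewrite antiperiodic_green by auto.
    rewrite <- RInt_Cinf_plus
      by (auto using Cinf_Derive; smooth_tac; now apply Cinf_Derive, Cinf_Derive).
    rewrite (RInt_ext _ (fun _ => 0)).
    - rewrite RInt_const. apply Rmult_0_r.
    - intros t _. rewrite Ds. as_real. ring. }
  transitivity (RInt (fun t => (q t + Derive (Derive q) t) * q t) 0 PI
     + (RInt (fun t => q t * s t) 0 PI
              + RInt (fun t => Derive (Derive q) t * s t) 0 PI)).
  - rewrite <- !RInt_Cinf_plus by smooth_tac. apply RInt_ext. intros t _.
    rewrite envelope_velocity by auto.
    unfold s, det, envelope, padd, pscal, nvec, tvec. cbn [fst snd].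
    assert (X := cos_sin_1 t).
    transitivity ((q t + Derive (Derive q) t) * q t * (cos t * cos t + sin t * sin t)
      + (q t + Derive (Derive q) t) * (fst p * cos t + snd p * sin t));
      [|rewrite X]; as_real; ring.
  - rewrite Z. apply Rplus_0_r.
Qed.

Lemma envelope_area p q : Cinf q -> antiperiodic q ->
  oriented_area (envelope p q) 0 PI = / 2 * RInt (fun t => q t ^ 2 - Derive q t ^ 2) 0 PI.
Proof.
  intros Hq Aq. rewrite envelope_area_second_order by auto. f_equal.
  assert (E := RInt_energy q Hq Aq).
  rewrite (RInt_ext (fun t => q t ^ 2 - Derive q t ^ 2)
    (fun t => -1 * (Derive q t ^ 2 - q t ^ 2))) by (intros; as_real; ring).
  assert (Hq' := Cinf_Derive q Hq).
  rewrite RInt_Cinf_scal, E.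
  { assert (K : forall x : R, x = -1 * - x) by (intros; ring). apply K. }
  smooth_tac.
Qed.

(** X' = (q + q'') tau. *)
Lemma envelope_constant_iff p q : Cinf q ->
  (exists c, forall t, envelope p q t = c) <-> (forall t, q t + Derive (Derive q) t = 0).
Proof.
  intros Hq. split.
  - intros [c Hc] t.
    assert (V := envelope_velocity p q t Hq).
    assert (V0 : velocity (envelope p q) t = (0, 0)).
    { unfold velocity. f_equal.
      - rewrite (Derive_ext _ (fun _ => fst c)); [apply Derive_const|].
        intros s. now rewrite Hc.
      - rewrite (Derive_ext _ (fun _ => snd c)); [apply Derive_const|].
        intros s. now rewrite Hc. }
    rewrite V0 in V. unfold pscal, tvec in V. injection V as V1 V2. simpl in V1, V2.
    assert (X := cos_sin_1 t).
    rewrite <- (Rmult_1_r (q t + _)), <- X.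
    transitivity ((q t + Derive (Derive q) t) * cos t * cos t
      - (q t + Derive (Derive q) t) * - sin t * sin t); [ring|].
    rewrite <- V1, <- V2. ring.
  - intros Z. exists (envelope p q 0). intros t.
    assert (V : forall s, velocity (envelope p q) s = (0, 0)).
    { intros s. rewrite envelope_velocity, Z by auto. unfold pscal. f_equal; ring. }
    assert (X1 : forall s, ex_derive q s) by (intros; now apply Cinf_ex_derive).
    assert (X2 : forall s, ex_derive (Derive q) s)
      by (intros; now apply Cinf_ex_derive, Cinf_Derive).
    rewrite (surjective_pairing (envelope p q t)), (surjective_pairing (envelope p q 0)).
    f_equal.
    + apply (constant_of_derive0 (fun s => fst (envelope p q s))). intros s.
      specialize (V s). apply (f_equal fst) in V.
      change (Derive (fun u => fst (envelope p q u)) s = 0) in V.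
      rewrite <- V. apply Derive_correct. unfold envelope, padd, pscal, nvec, tvec.
      cbn [fst snd]. auto_derive; auto.
    + apply (constant_of_derive0 (fun s => snd (envelope p q s))). intros s.
      specialize (V s). apply (f_equal snd) in V.
      change (Derive (fun u => snd (envelope p q u)) s = 0) in V.
      rewrite <- V. apply Derive_correct. unfold envelope, padd, pscal, nvec, tvec.
      cbn [fst snd]. auto_derive; auto.
Qed.

(** * Pointwise convergent series of functions *)

Lemma prefix_bounded (u : nat -> R) J :
  exists B, 0 <= B /\ forall j, (j < J)%nat -> Rabs (u j) <= B.
Proof.
  induction J as [|J [B [HB IH]]].
  - exists 0. split; [lra|]. intros j Hj. lia.
  - exists (B + Rabs (u J)). assert (X := Rabs_pos (u J)). split; [lra|].
    intros j Hj. destruct (Nat.eq_dec j J) as [->|N]; [lra|].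
    specialize (IH j ltac:(lia)). lra.
Qed.

(** If no interval carried a uniform bound, every interval would contain a
    smaller closed one on which some f_j exceeds n, by continuity. The common
    point of the nested intervals contradicts pointwise boundedness. *)
Lemma osgood (f : nat -> R -> R) :
  (forall j t, continuous (f j) t) ->
  (forall t, exists K, forall j, Rabs (f j t) <= K) ->
  exists x y K, x < y /\ forall t j, x <= t <= y -> Rabs (f j t) <= K.
Proof.
  intros Cf Bd. apply NNPP. intros No.
  assert (Step : forall (n : nat) (I : R * R), exists I' : R * R,
    fst I < snd I -> fst I < fst I' /\ fst I' < snd I' /\ snd I' < snd I /\
      exists j, forall t, fst I' <= t <= snd I' -> INR n < Rabs (f j t)).
  { intros n [x y]. simpl.
    destruct (Rlt_le_dec x y) as [L|L]; [|exists (x, y); lra].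
    assert (Ex : exists t j, x < t < y /\ INR n < Rabs (f j t)).
    { apply NNPP. intros No'. apply No.
      exists ((2 * x + y) / 3), ((x + 2 * y) / 3), (INR n). split; [lra|].
      intros t j Ht. destruct (Rle_lt_dec (Rabs (f j t)) (INR n)) as [G|G]; auto.
      exfalso. apply No'. exists t, j. split; [lra|auto]. }
    destruct Ex as [t [j [Ht Hj]]].
    assert (Ca : continuous (fun s => Rabs (f j s)) t).
    { apply (continuous_comp (f j) Rabs); auto. apply continuous_Rabs. }
    destruct (continuous_eps _ _ Ca (Rabs (f j t) - INR n) ltac:(lra)) as [d [Hd K]].
    set (e := Rmin d (Rmin (t - x) (y - t)) / 2).
    assert (M1 := Rmin_l d (Rmin (t - x) (y - t))).
    assert (M2 := Rmin_r d (Rmin (t - x) (y - t))).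
    assert (M3 := Rmin_l (t - x) (y - t)). assert (M4 := Rmin_r (t - x) (y - t)).
    assert (He : 0 < e).
    { unfold e. apply Rdiv_lt_0_compat; [|lra]. repeat apply Rmin_glb_lt; lra. }
    assert (E : 2 * e = Rmin d (Rmin (t - x) (y - t))) by (unfold e; field).
    exists (t - e, t + e). simpl. intros _. repeat split; try lra.
    exists j. intros s Hs.
    assert (Ks := K s ltac:(apply Rabs_def1; lra)). apply Rabs_def2 in Ks. lra. }
  set (F := fun n I => proj1_sig (constructive_indefinite_description _ (Step n I))).
  assert (HF : forall n I, fst I < snd I -> fst I < fst (F n I) /\
    fst (F n I) < snd (F n I) /\ snd (F n I) < snd I /\
      exists j, forall t, fst (F n I) <= t <= snd (F n I) -> INR n < Rabs (f j t)).
  { intros n I. unfold F.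
    destruct (constructive_indefinite_description _ (Step n I)) as [I' HI']. exact HI'. }
  set (I := fix I n := match n with O => (0, 1) | S k => F k (I k) end).
  assert (HI : forall n, fst (I n) < snd (I n)).
  { induction n as [|n IH]; [simpl; lra|].
    change (I (S n)) with (F n (I n)). now apply HF. }
  assert (Mono : forall n k, fst (I n) <= fst (I (n + k)%nat) /\
                             snd (I (n + k)%nat) <= snd (I n)).
  { intros n. induction k as [|k IH].
    - rewrite Nat.add_0_r. lra.
    - rewrite Nat.add_succ_r. change (I (S (n + k))) with (F (n + k)%nat (I (n + k)%nat)).
      destruct (HF (n + k)%nat _ (HI (n + k)%nat)) as [A1 [A2 [A3 _]]]. lra. }
  assert (Cross : forall n k, fst (I n) <= snd (I k)).
  { intros n k. destruct (Mono n k) as [A _]. destruct (Mono k n) as [_ B].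
    rewrite Nat.add_comm in B. specialize (HI (n + k)%nat). lra. }
  destruct (completeness (fun x => exists n, x = fst (I n))) as [t [U Lu]].
  - exists (snd (I 0%nat)). intros x [n ->]. apply Cross.
  - exists (fst (I 0%nat)). now exists 0%nat.
  - assert (Ht : forall n, fst (I n) <= t <= snd (I n)).
    { intros n. split.
      - apply U. now exists n.
      - apply Lu. intros x [k ->]. apply Cross. }
    destruct (Bd t) as [K HK].
    destruct (INR_unbounded K) as [n Hn].
    destruct (HF n (I n) (HI n)) as [_ [_ [_ [j Hj]]]].
    specialize (Hj t (Ht (S n))). specialize (HK j). lra.
Qed.

(** A telescoping majorant gives summability and an explicit tail bound at
    once. *)
Lemma telescoping_tail (u E : nat -> R) :
  (forall j, Rabs (u j) <= E j - E (S j)) -> is_lim_seq E 0 ->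
  ex_series u /\ forall N, Rabs (Series u - sum_n u N) <= E (S N).
Proof.
  intros H L.
  assert (SE : is_series (fun j => E j - E (S j)) (E 0%nat)).
  { change (is_lim_seq (sum_n (fun j => E j - E (S j))) (E 0%nat)).
    apply (is_lim_seq_ext (fun n => E 0%nat - E (S n))).
    - induction n as [|n IH]; [now rewrite sum_O|].
      rewrite sum_Sn, <- IH. unfold plus. simpl. ring.
    - replace (Finite (E 0%nat)) with (Rbar_minus (E 0%nat) 0)
        by (simpl; f_equal; ring).
      apply is_lim_seq_minus'; [apply is_lim_seq_const|].
      now apply is_lim_seq_incr_1 in L. }
  assert (Ex : ex_series u).
  { apply (ex_series_le u (fun j => E j - E (S j))); auto. now exists (E 0%nat). }
  split; auto. intros N.
  assert (Cau : forall k, Rabs (sum_n u (N + k) - sum_n u N) <= E (S N) - E (S (N + k))).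
  { induction k as [|k IH].
    - rewrite Nat.add_0_r, Rminus_diag, Rabs_R0. lra.
    - rewrite Nat.add_succ_r, sum_Sn. unfold plus. simpl.
      replace (sum_n u (N + k) + u (S (N + k)) - sum_n u N)
        with ((sum_n u (N + k) - sum_n u N) + u (S (N + k))) by ring.
      eapply Rle_trans; [apply Rabs_triang|]. specialize (H (S (N + k))). lra. }
  assert (LU : is_lim_seq (fun k => Rabs (sum_n u (N + k) - sum_n u N))
                 (Rabs (Series u - sum_n u N))).
  { apply (is_lim_seq_abs _ (Finite (Series u - sum_n u N))).
    apply is_lim_seq_minus'; [|apply is_lim_seq_const].
    apply (is_lim_seq_ext (fun k => sum_n u (k + N))).
    - intros k. now rewrite Nat.add_comm.
    - apply is_lim_seq_incr_n. exact (Series_correct _ Ex). }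
  assert (LE : is_lim_seq (fun k => E (S N) - E (S (N + k))) (E (S N) - 0)).
  { apply is_lim_seq_minus'; [apply is_lim_seq_const|].
    apply (is_lim_seq_ext (fun k => E (k + S N)%nat)).
    - intros k. f_equal. lia.
    - now apply is_lim_seq_incr_n. }
  rewrite Rminus_0_r in LE.
  exact (is_lim_seq_le _ _ _ _ Cau LU LE).
Qed.

Lemma sum_n_continuous (f : nat -> R -> R) N t :
  (forall j, continuous (f j) t) -> continuous (fun s => sum_n (fun j => f j s) N) t.
Proof.
  intros Cf. induction N as [|N IH].
  - apply continuous_ext with (f 0%nat); auto. intros; now rewrite sum_O.
  - apply continuous_ext with (fun s => sum_n (fun j => f j s) N + f (S N) s).
    + intros; now rewrite sum_Sn.
    + apply (continuous_plus (fun s => sum_n (fun j => f j s) N) (f (S N))); auto.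
Qed.

Lemma normal_series_continuous (f : nat -> R -> R) (E : nat -> R) :
  (forall j t, continuous (f j) t) ->
  (forall j t, Rabs (f j t) <= E j - E (S j)) -> is_lim_seq E 0 ->
  forall t, continuous (fun t => Series (fun j => f j t)) t.
Proof.
  intros f_cont f_bound E_lim t. set (F := fun t => Series (fun j => f j t)).
  apply eps_continuous. intros eps He.
  assert (L := proj1 (is_lim_seq_incr_1 E 0) E_lim).
  apply is_lim_seq_spec in L.
  destruct (L (mkposreal (eps / 3) ltac:(lra))) as [N HN]. simpl in HN.
  specialize (HN N (le_n N)). rewrite Rminus_0_r in HN.
  assert (C := sum_n_continuous f N t (fun j => f_cont j t)).
  destruct (continuous_eps _ _ C (eps / 3) ltac:(lra)) as [d [Hd K]].
  exists d. split; auto. intros y Hy. specialize (K y Hy).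
  assert (B : forall s, Rabs (F s - sum_n (fun j => f j s) N) < eps / 3).
  { intros s. destruct (telescoping_tail (fun j => f j s) E) as [_ T]; auto.
    eapply Rle_lt_trans; [apply T|]. eapply Rle_lt_trans; [apply Rle_abs|]. exact HN. }
  assert (B1 := B y). assert (B2 := B t).
  apply Rabs_def2 in K. apply Rabs_def2 in B1. apply Rabs_def2 in B2.
  fold (F y) (F t). apply Rabs_def1; lra.
Qed.

Lemma normal_series_RInt (f : nat -> R -> R) (E : nat -> R) (psi : R -> R) a b :
  (forall j t, continuous (f j) t) ->
  (forall j t, Rabs (f j t) <= E j - E (S j)) -> is_lim_seq E 0 ->
  (forall t, continuous psi t) -> a <= b ->
  is_series (fun j => RInt (fun t => f j t * psi t) a b)
            (RInt (fun t => Series (fun j => f j t) * psi t) a b).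
Proof.
  intros f_cont f_bound E_lim Cpsi Hab. set (F := fun t => Series (fun j => f j t)).
  assert (If : forall j, ex_RInt (fun t => f j t * psi t) a b).
  { intros. apply (ex_RInt_continuous (V := R_CompleteNormedModule)).
    intros. apply (continuous_mult (f j) psi); auto. }
  assert (IF : ex_RInt (fun t => F t * psi t) a b).
  { apply (ex_RInt_continuous (V := R_CompleteNormedModule)).
    intros. apply (continuous_mult F psi); auto.
    now apply normal_series_continuous with E. }
  assert (IS : forall N, is_RInt (fun t => sum_n (fun j => f j t) N * psi t) a b
                 (sum_n (fun j => RInt (fun t => f j t * psi t) a b) N)).
  { induction N as [|N IH].
    - rewrite sum_O. apply (is_RInt_ext (fun t => f 0%nat t * psi t));
        [intros; now rewrite sum_O|].
      now apply (RInt_correct (fun t => f 0%nat t * psi t)).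
    - rewrite sum_Sn. apply (is_RInt_ext
        (fun t => plus (sum_n (fun j => f j t) N * psi t) (f (S N) t * psi t))).
      + intros t _. rewrite sum_Sn. unfold plus. simpl. symmetry.
        apply Rmult_plus_distr_r.
      + apply (is_RInt_plus (fun t => sum_n (fun j => f j t) N * psi t)
          (fun t => f (S N) t * psi t)); auto.
        now apply (RInt_correct (fun t => f (S N) t * psi t)). }
  destruct (continuity_ab_maj (fun t => Rabs (psi t)) a b Hab) as [x [Hx _]].
  { intros c _. apply continuity_pt_filterlim.
    apply (continuous_comp psi Rabs); auto. apply continuous_Rabs. }
  set (M := Rabs (psi x)) in *. assert (HM : 0 <= M) by apply Rabs_pos.
  change (is_lim_seq (sum_n (fun j => RInt (fun t => f j t * psi t) a b))
            (RInt (fun t => F t * psi t) a b)).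
  apply is_lim_seq_spec. intros eps.
  assert (L := proj1 (is_lim_seq_incr_1 E 0) E_lim).
  apply is_lim_seq_spec in L.
  assert (HD : 0 < (b - a) * M + 1).
  { assert (0 <= (b - a) * M) by (apply Rmult_le_pos; lra). lra. }
  assert (Hd : 0 < eps / ((b - a) * M + 1)).
  { apply Rdiv_lt_0_compat; [apply cond_pos|lra]. }
  destruct (L (mkposreal _ Hd)) as [N HN]. simpl in HN.
  exists N. intros n Hn. specialize (HN n Hn). rewrite Rminus_0_r in HN.
  assert (B : Rabs (sum_n (fun j => RInt (fun t => f j t * psi t) a b) n
                    - RInt (fun t => F t * psi t) a b) <= (b - a) * (E (S n) * M)).
  { assert (D := is_RInt_minus _ _ _ _ _ _ (IS n) (RInt_correct _ a b IF)).
    assert (Q : Rabs (RInt (fun t => sum_n (fun j => f j t) n * psi t - F t * psi t) a b)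
                <= (b - a) * (E (S n) * M)).
    { apply abs_RInt_le_const; auto.
      - eexists. exact D.
      - intros t Ht. rewrite <- Rmult_minus_distr_r, Rabs_mult.
        apply Rmult_le_compat; auto using Rabs_pos.
        rewrite Rabs_minus_sym.
        destruct (telescoping_tail (fun j => f j t) E) as [_ T]; auto. }
    apply (is_RInt_unique
      (fun t => sum_n (fun j => f j t) n * psi t - F t * psi t)) in D.
    rewrite D in Q. exact Q. }
  eapply Rle_lt_trans; [exact B|].
  assert (E (S n) <= eps / ((b - a) * M + 1)).
  { eapply Rle_trans; [apply Rle_abs|]. now left. }
  apply Rle_lt_trans with ((b - a) * M * (eps / ((b - a) * M + 1))).
  - replace ((b - a) * (E (S n) * M)) with ((b - a) * M * E (S n)) by ring.
    apply Rmult_le_compat_l; auto. apply Rmult_le_pos; lra.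
  - replace (pos eps)
      with (((b - a) * M + 1) * (eps / ((b - a) * M + 1))) at 2 by (field; lra).
    apply Rmult_lt_compat_r; lra.
Qed.

(** Summation by parts moves the differences onto the multipliers u. The
    remainders of the series are small from the index J on, where the total
    variation of u is at most V; before J they are bounded by B, and the
    variation is at most W J, which the applications make small. The numbers J
    and B do not depend on u. *)
Lemma abel_multipliers (A : nat -> R) s : is_series A s ->
  forall eps, 0 < eps -> exists J B, 0 <= B /\
  forall (u W : nat -> R) V L,
    (forall j, Rabs (u (S j) - u j) <= W (S j) - W j) ->
    (forall j, 0 <= W j <= V) -> (forall j, Rabs (u j) <= 1) ->
    is_series (fun j => A j * u j) L ->
    Rabs (L - s * u 0%nat) <= B * W J + eps * (V + 1).
Proof.
  intros HA eps He. set (P := fun j => sum_n A j - s).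
  assert (L0 : is_lim_seq (sum_n A) s) by exact HA. apply is_lim_seq_spec in L0.
  destruct (L0 (mkposreal eps He)) as [J HJ]. simpl in HJ.
  destruct (prefix_bounded P J) as [B [HB PB]].
  exists J, B. split; auto. intros u W V L Du HW Hu HL.
  assert (WS : forall j, W j <= W (S j)).
  { intros j. specialize (Du j). generalize (Rabs_pos (u (S j) - u j)). lra. }
  assert (Wmono : forall k j, W j <= W (j + k)%nat).
  { induction k as [|k IH]; intros j; [rewrite Nat.add_0_r; lra|].
    rewrite Nat.add_succ_r. eapply Rle_trans; [apply IH|apply WS]. }
  assert (Claim : forall N,
    Rabs (sum_n (fun j => A j * u j) N - s * u 0%nat - P N * u N)
      <= B * W (Nat.min N J) + eps * W N).
  { induction N as [|N IH].
    - rewrite sum_O. unfold P. rewrite sum_O.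
      replace (A 0%nat * u 0%nat - s * u 0%nat - (A 0%nat - s) * u 0%nat) with 0 by ring.
      rewrite Rabs_R0.
      apply Rplus_le_le_0_compat; apply Rmult_le_pos; try lra; apply HW.
    - rewrite sum_Sn. unfold plus. simpl AbelianMonoid.sort.
      assert (PS : P (S N) = P N + A (S N)).
      { unfold P. rewrite sum_Sn. unfold plus. simpl. ring. }
      rewrite PS.
      match goal with |- Rabs ?x <= _ => replace x with
        ((sum_n (fun j => A j * u j) N - s * u 0%nat - P N * u N)
         + - (P N * (u (S N) - u N))) by (simpl; ring) end.
      eapply Rle_trans; [apply Rabs_triang|].
      rewrite Rabs_Ropp, Rabs_mult.
      assert (D := Du N). assert (W1 := WS N).
      assert (Ap := Rabs_pos (u (S N) - u N)). assert (Pp := Rabs_pos (P N)).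
      destruct (Nat.lt_ge_cases N J) as [C|C].
      + rewrite Nat.min_l in IH by lia. rewrite Nat.min_l by lia.
        specialize (PB N C).
        assert (Rabs (P N) * Rabs (u (S N) - u N) <= B * (W (S N) - W N))
          by (apply Rmult_le_compat; auto).
        assert (eps * W N <= eps * W (S N)) by (apply Rmult_le_compat_l; lra).
        lra.
      + rewrite Nat.min_r in IH by lia. rewrite Nat.min_r by lia.
        specialize (HJ N C). fold (P N) in HJ.
        assert (Rabs (P N) * Rabs (u (S N) - u N) <= eps * (W (S N) - W N))
          by (apply Rmult_le_compat; auto; lra).
        lra. }
  assert (Bound : forall k, Rabs (sum_n (fun j => A j * u j) (k + J) - s * u 0%nat)
       <= B * W J + eps * (V + 1)).
  { intros k. specialize (Claim (k + J)%nat). rewrite Nat.min_r in Claim by lia.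
    specialize (HJ (k + J)%nat ltac:(lia)). fold (P (k + J)%nat) in HJ.
    assert (HV := HW (k + J)%nat). assert (Hu' := Hu (k + J)%nat).
    assert (Pu : Rabs (P (k + J)%nat * u (k + J)%nat) <= eps * 1).
    { rewrite Rabs_mult. apply Rmult_le_compat; auto using Rabs_pos. now left. }
    assert (eps * W (k + J)%nat <= eps * V) by (apply Rmult_le_compat_l; lra).
    replace (sum_n (fun j => A j * u j) (k + J) - s * u 0%nat) with
      ((sum_n (fun j => A j * u j) (k + J) - s * u 0%nat - P (k + J)%nat * u (k + J)%nat)
       + P (k + J)%nat * u (k + J)%nat) by ring.
    eapply Rle_trans; [apply Rabs_triang|]. lra. }
  assert (LL : is_lim_seq
     (fun k => Rabs (sum_n (fun j => A j * u j) (k + J) - s * u 0%nat))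
     (Rabs (L - s * u 0%nat))).
  { apply (is_lim_seq_abs _ (Finite (L - s * u 0%nat))).
    apply is_lim_seq_minus'; [|apply is_lim_seq_const].
    apply is_lim_seq_incr_n with (u := sum_n (fun j => A j * u j)). exact HL. }
  exact (is_lim_seq_le _ _ _ _ Bound LL (is_lim_seq_const _)).
Qed.

Definition second_difference (G : R -> R) (x h : R) : R :=
  G (x + h) + G (x - h) - 2 * G x.

Lemma second_difference_C2 (K K1 q : R -> R) x :
  (forall t, is_derive K t (K1 t)) -> (forall t, is_derive K1 t (q t)) ->
  continuous q x ->
  forall eps, 0 < eps -> exists d, 0 < d /\ forall h, 0 < h < d ->
    Rabs (second_difference K x h - h ^ 2 * q x) <= eps * h ^ 2.
Proof.
  intros D1 D2 Cq eps He.
  destruct (continuous_eps q x Cq (eps / 2) ltac:(lra)) as [d [Hd Q]].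
  exists d. split; auto. intros h Hh.
  destruct (MVT_cor2 (fun h => second_difference K x h - h ^ 2 * q x)
    (fun h => K1 (x + h) - K1 (x - h) - 2 * h * q x) 0 h) as [z [Ez Hz]].
  - lra.
  - intros c _. apply is_derive_Reals. unfold second_difference.
    assert (X1 : ex_derive K (x + c)) by (eexists; apply D1).
    assert (X2 : ex_derive K (x - c)) by (eexists; apply D1).
    auto_derive; auto.
    change (Derive (fun x => K x)) with (Derive K). unfold Rminus.
    rewrite !(is_derive_unique _ _ _ (D1 _)). ring.
  - destruct (MVT_cor2 (fun h => K1 (x + h) - K1 (x - h) - 2 * h * q x)
      (fun h => q (x + h) + q (x - h) - 2 * q x) 0 z) as [y [Ey Hy]].
    + lra.
    + intros c _. apply is_derive_Reals.
      assert (X1 : ex_derive K1 (x + c)) by (eexists; apply D2).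
      assert (X2 : ex_derive K1 (x - c)) by (eexists; apply D2).
      auto_derive; auto.
      change (Derive (fun x => K1 x)) with (Derive K1). unfold Rminus.
      rewrite !(is_derive_unique _ _ _ (D2 _)). ring.
    + unfold second_difference in Ez |- *.
      rewrite !Rplus_0_r, !Rminus_0_r in Ez, Ey.
      replace (K x + K x - 2 * K x - 0 ^ 2 * q x) with 0 in Ez by ring.
      replace (K1 x - K1 x - 2 * 0 * q x) with 0 in Ey by ring.
      rewrite Rminus_0_r in Ez, Ey. rewrite Ez, Ey, !Rabs_mult.
      rewrite (Rabs_pos_eq z), (Rabs_pos_eq h) by lra.
      assert (Q1 := Q (x + y)). assert (Q2 := Q (x - y)).
      replace (x + y - x) with y in Q1 by ring.
      replace (x - y - x) with (- y) in Q2 by ring.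
      rewrite Rabs_Ropp in Q2. rewrite Rabs_pos_eq in Q1, Q2 by lra.
      specialize (Q1 ltac:(lra)). specialize (Q2 ltac:(lra)).
      apply Rabs_def2 in Q1. apply Rabs_def2 in Q2.
      assert (Rabs (q (x + y) + q (x - y) - 2 * q x) <= eps).
      { apply Rabs_le. lra. }
      replace (eps * h ^ 2) with (eps * h * h) by ring.
      apply Rmult_le_compat_r; [lra|].
      apply Rmult_le_compat; auto using Rabs_pos; lra.
Qed.

(** If G were positive somewhere, subtracting a small multiple of the parabola
    (x - a)(b - x) would leave an interior maximum, where the second difference
    is nonpositive; but the parabola adds the positive amount 2 eta h^2, more
    than G can compensate. *)
Lemma schwarz_nonpos (G : R -> R) a b :
  (forall t, continuous G t) ->
  (forall x eps, 0 < eps -> exists d, 0 < d /\ forall h, 0 < h < d ->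
     Rabs (second_difference G x h) <= eps * h ^ 2) ->
  G a = 0 -> G b = 0 -> forall c, a < c < b -> G c <= 0.
Proof.
  intros CG S Ga Gb c Hc.
  destruct (Rle_lt_dec (G c) 0) as [L|L]; auto. exfalso.
  assert (Hm : 0 < (c - a) * (b - c)) by (apply Rmult_lt_0_compat; lra).
  set (eta := G c / (2 * ((c - a) * (b - c)))).
  assert (Heta : 0 < eta) by (apply Rdiv_lt_0_compat; lra).
  set (phi := fun x => G x - eta * ((x - a) * (b - x))).
  assert (Pc : 0 < phi c).
  { unfold phi. replace (eta * ((c - a) * (b - c))) with (G c / 2)
      by (unfold eta; field; split; lra). lra. }
  destruct (continuity_ab_maj phi a b) as [M [HM Mab]].
  - lra.
  - intros t _. apply continuity_pt_filterlim.
    apply (continuous_minus G (fun x => eta * ((x - a) * (b - x)))); auto.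
    apply (ex_derive_continuous (fun x => eta * ((x - a) * (b - x)))).
    auto_derive; auto.
  - assert (PM := HM c ltac:(lra)).
    assert (Ma : M <> a).
    { intros ->. unfold phi in PM at 2. rewrite Ga, Rminus_diag in PM. lra. }
    assert (Mb : M <> b).
    { intros ->. unfold phi in PM at 2. rewrite Gb, Rminus_diag in PM. lra. }
    destruct (S M eta Heta) as [d [Hd K]].
    set (h := Rmin d (Rmin (M - a) (b - M)) / 2).
    assert (M1 := Rmin_l d (Rmin (M - a) (b - M))).
    assert (M2 := Rmin_r d (Rmin (M - a) (b - M))).
    assert (M3 := Rmin_l (M - a) (b - M)). assert (M4 := Rmin_r (M - a) (b - M)).
    assert (Hh : 0 < h).
    { unfold h. apply Rdiv_lt_0_compat; [|lra]. repeat apply Rmin_glb_lt; lra. }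
    assert (Eh : 2 * h = Rmin d (Rmin (M - a) (b - M))) by (unfold h; field).
    specialize (K h ltac:(lra)).
    assert (A1 := HM (M + h) ltac:(lra)). assert (A2 := HM (M - h) ltac:(lra)).
    unfold phi in A1, A2. unfold second_difference in K.
    apply Rabs_le_between in K.
    assert (0 < eta * h ^ 2) by (apply Rmult_lt_0_compat; auto; apply pow_lt; auto).
    lra.
Qed.

Lemma schwarz_affine (G : R -> R) :
  (forall t, continuous G t) ->
  (forall x eps, 0 < eps -> exists d, 0 < d /\ forall h, 0 < h < d ->
     Rabs (second_difference G x h) <= eps * h ^ 2) ->
  forall x, G x = G 0 + x * (G 1 - G 0).
Proof.
  intros CG S.
  assert (Chord : forall a b c, a < c < b ->
     (G c - G a) * (b - a) = (c - a) * (G b - G a)).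
  { intros a b c Hc.
    assert (Half : forall sg, sg = 1 \/ sg = -1 ->
      sg * ((G c - G a) * (b - a) - (c - a) * (G b - G a)) <= 0).
    { intros sg Hsg.
      apply (schwarz_nonpos (fun t => sg * ((G t - G a) * (b - a) - (t - a) * (G b - G a)))
               a b); auto; try ring.
      - intros t.
        apply (continuous_mult (fun _ => sg)
          (fun t => (G t - G a) * (b - a) - (t - a) * (G b - G a)));
          [apply continuous_const|].
        apply (continuous_minus (fun t => (G t - G a) * (b - a))
                 (fun t => (t - a) * (G b - G a))).
        + apply (continuous_mult (fun t => G t - G a) (fun _ => b - a));
            [|apply continuous_const].
          apply (continuous_minus G (fun _ => G a)); auto. apply continuous_const.
        + apply (ex_derive_continuous (fun t => (t - a) * (G b - G a))).
          auto_derive; auto.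
      - intros x eps He.
        destruct (S x (eps / (b - a)) ltac:(apply Rdiv_lt_0_compat; lra)) as [d [Hd K]].
        exists d. split; auto. intros h Hh. specialize (K h Hh).
        replace (second_difference _ x h)
          with (sg * (b - a) * second_difference G x h)
          by (unfold second_difference; ring).
        rewrite !Rabs_mult, (Rabs_pos_eq (b - a)) by lra.
        replace (Rabs sg) with 1.
        2:{ destruct Hsg as [-> | ->]; [now rewrite Rabs_R1|].
            unfold Rabs. destruct Rcase_abs; lra. }
        apply (Rmult_le_compat_l (b - a)) in K; [|lra].
        replace ((b - a) * (eps / (b - a) * h ^ 2)) with (eps * h ^ 2) in K
          by (field; lra). lra. }
    assert (H1 := Half 1 (or_introl eq_refl)).
    assert (H2 := Half (-1) (or_intror eq_refl)). lra. }
  intros x.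
  destruct (Rtotal_order x 0) as [L|[->|L]]; [|ring|].
  - assert (E := Chord x 1 0 ltac:(lra)). lra.
  - destruct (Rtotal_order x 1) as [K|[->|K]]; [|ring|].
    + assert (E := Chord 0 1 x ltac:(lra)). lra.
    + assert (E := Chord 0 x 1 ltac:(lra)). lra.
Qed.

(** * Trigonometric series with odd frequencies *)

Definition wave (a b m t : R) : R := a * cos (m * t) + b * sin (m * t).

Lemma Cinf_wave a b m : Cinf (wave a b m).
Proof. unfold wave. smooth_tac. Qed.

(** A shift by a quarter of a period turns the cosine into the sine, so one of
    the two values is comparable to the amplitude. *)
Lemma wave_quarter_period a b m t : m <> 0 ->
  wave a b m t ^ 2 + wave a b m (t + PI / 2 / m) ^ 2 = a ^ 2 + b ^ 2.
Proof.
  intros Hm. unfold wave.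
  replace (m * (t + PI / 2 / m)) with (PI / 2 + m * t) by (field; auto).
  rewrite <- cos_sin. replace (cos (PI / 2 + m * t)) with (- sin (m * t))
    by (rewrite (sin_cos (m * t)); ring).
  assert (X := cos_sin_1 (m * t)).
  transitivity ((a ^ 2 + b ^ 2) * (cos (m * t) * cos (m * t) + sin (m * t) * sin (m * t)));
    [|rewrite X]; ring.
Qed.

Lemma wave_sq_le a b m t : wave a b m t ^ 2 <= a ^ 2 + b ^ 2.
Proof.
  unfold wave. assert (X := cos_sin_1 (m * t)).
  assert (Y := Rle_0_sqr (a * sin (m * t) - b * cos (m * t))). unfold Rsqr in Y.
  replace (a ^ 2 + b ^ 2) with
    ((a ^ 2 + b ^ 2) * (cos (m * t) * cos (m * t) + sin (m * t) * sin (m * t)))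
    by (rewrite X; ring).
  lra.
Qed.

Lemma Rabs_le_1_sq x : Rabs x <= 1 + x ^ 2.
Proof. unfold Rabs. destruct Rcase_abs; nra. Qed.

(** A uniform bound on an interval of length at least a quarter of a period
    bounds the amplitude; this covers all but finitely many frequencies. *)
Lemma cantor_lebesgue_bounded (al be mu : nat -> R) :
  (forall j, INR j < mu j) ->
  (forall t, exists K, forall j, Rabs (wave (al j) (be j) (mu j) t) <= K) ->
  exists M, 0 <= M /\ forall j, al j ^ 2 + be j ^ 2 <= M.
Proof.
  intros Hmu Bd.
  destruct (osgood (fun j => wave (al j) (be j) (mu j))) as [x [y [K [L B]]]]; auto.
  { intros j t. apply Cinf_continuous, Cinf_wave. }
  (* from the index J on, a quarter period fits into the interval *)
  destruct (INR_unbounded (PI / 2 / (y - x))) as [J HJ].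
  destruct (prefix_bounded (fun j => al j ^ 2 + be j ^ 2) J) as [M [HM PM]].
  exists (M + 2 * K ^ 2). assert (K2 := pow2_ge_0 K). split; [lra|].
  intros j. destruct (Nat.lt_ge_cases j J) as [C|C].
  - specialize (PM j C). generalize (Rle_abs (al j ^ 2 + be j ^ 2)). lra.
  - assert (Mj := Hmu j). apply le_INR in C.
    assert (Pj : 0 < mu j) by (generalize (pos_INR j); lra).
    rewrite <- (wave_quarter_period (al j) (be j) (mu j) x) by lra.
    assert (P0 := PI_RGT_0).
    assert (Sh : PI / 2 / mu j <= y - x).
    { apply (Rmult_le_reg_r (mu j)); auto.
      replace (PI / 2 / mu j * mu j) with (PI / 2) by (field; lra).
      assert (PI / 2 / (y - x) * (y - x) <= mu j * (y - x))
        by (apply Rmult_le_compat_r; lra).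
      replace (PI / 2 / (y - x) * (y - x)) with (PI / 2) in H by (field; lra). lra. }
    assert (Sh0 : 0 < PI / 2 / mu j) by (apply Rdiv_lt_0_compat; lra).
    assert (Sq : forall t, x <= t <= y -> wave (al j) (be j) (mu j) t ^ 2 <= K ^ 2).
    { intros t Ht. rewrite <- (pow2_abs (wave _ _ _ _)).
      apply pow_incr. split; [apply Rabs_pos|]. now apply B. }
    assert (S1 := Sq x ltac:(lra)). assert (S2 := Sq (x + PI / 2 / mu j) ltac:(lra)).
    lra.
Qed.

(** The multiplier by which a second difference of step 2 h acts on a wave of
    frequency x / h, relative to its second derivative. *)
Definition sinc_sq (x : R) : R := (sin x / x) ^ 2.

Lemma abs_sin_le x : 0 < x -> Rabs (sin x) <= x.
Proof.
  intros Hx. apply Rabs_le. split.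
  - assert (K : - sin 0 - 0 <= sin x + x); [|rewrite sin_0 in K; lra].
    replace (- sin 0 - 0) with (sin 0 + 0) by (rewrite sin_0; ring).
    apply (nondecreasing_of_derive (fun x => sin x + x) (fun x => cos x + 1)); [| |lra].
    + intros t _. auto_derive; auto. ring.
    + intros t _. generalize (COS_bound t). lra.
  - left. now apply sin_lt_x.
Qed.

Lemma sinc_sq_le1 x : 0 < x -> Rabs (sinc_sq x) <= 1.
Proof.
  intros Hx. unfold sinc_sq. rewrite <- RPow_abs.
  replace 1 with (1 ^ 2) by ring. apply pow_incr. split; [apply Rabs_pos|].
  unfold Rdiv. rewrite Rabs_mult, Rabs_inv, (Rabs_pos_eq x) by lra.
  apply (Rmult_le_reg_r x); auto. rewrite Rmult_assoc, Rinv_l by lra.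
  generalize (abs_sin_le x Hx). lra.
Qed.

Lemma sinc_sq_at_0 eps : 0 < eps ->
  exists d, 0 < d /\ forall x, 0 < x < d -> Rabs (sinc_sq x - 1) <= eps.
Proof.
  intros He. destruct (derivable_pt_lim_sin_0 (eps / 2) ltac:(lra)) as [d Hd].
  exists d. split; [apply cond_pos|]. intros x Hx.
  specialize (Hd x ltac:(lra)). rewrite Rabs_pos_eq in Hd by lra.
  specialize (Hd ltac:(lra)). rewrite Rplus_0_l, sin_0, Rminus_0_r in Hd.
  assert (S := sinc_sq_le1 x ltac:(lra)). unfold sinc_sq in *.
  set (s := sin x / x) in *. rewrite <- RPow_abs in S.
  assert (Rabs s <= 1).
  { destruct (Rle_lt_dec (Rabs s) 1) as [L|L]; auto. nra. }
  replace (s ^ 2 - 1) with ((s - 1) * (s + 1)) by ring. rewrite Rabs_mult.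
  replace eps with (eps / 2 * 2) by field.
  apply Rmult_le_compat; auto using Rabs_pos; [lra|].
  apply Rabs_le_between in H. apply Rabs_le. lra.
Qed.

(** Near 0 the numerator is O(x^3), because x cos x - sin x has derivative
    - x sin x; for x > 1 it is O(x). *)
Lemma sinc_sq_derivative_bound x : 0 < x ->
  is_derive sinc_sq x (2 * sin x * (x * cos x - sin x) / x ^ 3) /\
  Rabs (2 * sin x * (x * cos x - sin x) / x ^ 3) <= 8 * / (1 + x ^ 2).
Proof.
  intros Hx. split.
  - unfold sinc_sq. auto_derive; [lra|]. field. lra.
  - assert (P3 : 0 < x ^ 3) by now apply pow_lt.
    assert (P2 : 0 < 1 + x ^ 2) by (generalize (pow2_ge_0 x); lra).
    unfold Rdiv. rewrite !Rabs_mult, Rabs_inv, (Rabs_pos_eq 2), (Rabs_pos_eq (x ^ 3)) by lra.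
    apply (Rmult_le_reg_r (x ^ 3 * (1 + x ^ 2))); [now apply Rmult_lt_0_compat|].
    replace (2 * Rabs (sin x) * Rabs (x * cos x - sin x) * / x ^ 3 * (x ^ 3 * (1 + x ^ 2)))
      with (2 * Rabs (sin x) * Rabs (x * cos x - sin x) * (1 + x ^ 2)) by (field; lra).
    replace (8 * / (1 + x ^ 2) * (x ^ 3 * (1 + x ^ 2))) with (8 * x ^ 3) by (field; lra).
    assert (A1 := abs_sin_le x Hx).
    assert (A2 : Rabs (sin x) <= 1) by (apply Rabs_le, SIN_bound).
    assert (A0 := Rabs_pos (sin x)). assert (B0 := Rabs_pos (x * cos x - sin x)).
    destruct (Rle_lt_dec x 1) as [L|L].
    + assert (B : Rabs (x * cos x - sin x) <= x * x).
      { destruct (MVT_cor2 (fun x => x * cos x - sin x) (fun x => - x * sin x) 0 x)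
          as [z [Ez Hz]]; auto.
        - intros c _. apply is_derive_Reals. auto_derive; auto. ring.
        - rewrite sin_0, Rmult_0_l, !Rminus_0_r in Ez. rewrite Ez, !Rabs_mult, Rabs_Ropp.
          rewrite (Rabs_pos_eq z), (Rabs_pos_eq x) by lra.
          assert (Rabs (sin z) <= 1) by (apply Rabs_le, SIN_bound).
          assert (Q := Rabs_pos (sin z)).
          apply Rmult_le_compat_r; [lra|]. nra. }
      apply Rle_trans with (2 * x * (x * x) * (1 + 1)).
      * apply Rmult_le_compat; nra.
      * simpl. nra.
    + assert (B : Rabs (x * cos x - sin x) <= 2 * x).
      { generalize (COS_bound x) (SIN_bound x). intros. apply Rabs_le. nra. }
      apply Rle_trans with (2 * 1 * (2 * x) * (2 * x ^ 2)).
      * apply Rmult_le_compat; nra.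
      * simpl. nra.
Qed.

(** The arctangent is a bounded function that dominates the variation on the
    whole half-line and is small near 0. *)
Lemma sinc_sq_variation x y : 0 < x -> x <= y ->
  Rabs (sinc_sq y - sinc_sq x) <= 8 * atan y - 8 * atan x.
Proof.
  intros Hx Hxy.
  set (u' := fun x => 2 * sin x * (x * cos x - sin x) / x ^ 3).
  assert (Da : forall t, is_derive (fun x => 8 * atan x) t (8 * / (1 + t ^ 2))).
  { intros t. apply (is_derive_scal atan t 8).
    replace (1 + t ^ 2) with (1 + t²) by (unfold Rsqr; ring). apply is_derive_atan. }
  assert (M1 : 8 * atan x - sinc_sq x <= 8 * atan y - sinc_sq y).
  { apply (nondecreasing_of_derive (fun x => 8 * atan x - sinc_sq x)
      (fun x => 8 * / (1 + x ^ 2) - u' x)); auto.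
    - intros t Ht. destruct (sinc_sq_derivative_bound t) as [D _]; [lra|].
      apply (is_derive_minus (fun x => 8 * atan x) sinc_sq); auto.
    - intros t Ht. destruct (sinc_sq_derivative_bound t) as [_ B]; [lra|].
      apply Rabs_le_between in B. unfold u'. lra. }
  assert (M2 : 8 * atan x + sinc_sq x <= 8 * atan y + sinc_sq y).
  { apply (nondecreasing_of_derive (fun x => 8 * atan x + sinc_sq x)
      (fun x => 8 * / (1 + x ^ 2) + u' x)); auto.
    - intros t Ht. destruct (sinc_sq_derivative_bound t) as [D _]; [lra|].
      apply (is_derive_plus (fun x => 8 * atan x) sinc_sq); auto.
    - intros t Ht. destruct (sinc_sq_derivative_bound t) as [_ B]; [lra|].
      apply Rabs_le_between in B. unfold u'. lra. }
  apply Rabs_le. lra.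
Qed.

Lemma atan_between x : 0 <= x -> 0 <= atan x <= x /\ atan x <= 2.
Proof.
  intros Hx. assert (B := atan_bound x). assert (P4 := PI_4).
  assert (M1 : atan 0 <= atan x).
  { apply (nondecreasing_of_derive atan (fun x => / (1 + x²))); auto.
    - intros; apply is_derive_atan.
    - intros t _. left. apply Rinv_0_lt_compat. generalize (Rle_0_sqr t). lra. }
  assert (M2 : 0 - atan 0 <= x - atan x).
  { apply (nondecreasing_of_derive (fun x => x - atan x) (fun x => 1 - / (1 + x²))); auto.
    - intros. apply (is_derive_minus (fun x => x) atan); [exact (is_derive_id t)|].
      apply is_derive_atan.
    - intros t _. assert (0 <= t²) by apply Rle_0_sqr.
      assert (/ (1 + t²) <= / 1) by (apply Rinv_le_contravar; lra). lra. }
  rewrite atan_0 in M1, M2. lra.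
Qed.

(** Riemann's first lemma, in the form of a summation method: a convergent
    series keeps its sum under the multipliers (sin(mu h) / (mu h))^2 as h tends
    to 0. *)
Lemma riemann_summation (A mu : nat -> R) s :
  (forall j, 0 < mu j) -> (forall j, mu j <= mu (S j)) -> is_series A s ->
  forall eps, 0 < eps -> exists d, 0 < d /\ forall h L, 0 < h < d ->
    is_series (fun j => A j * sinc_sq (mu j * h)) L -> Rabs (L - s) <= eps.
Proof.
  intros Pmu Mmu HA eps He.
  destruct (abel_multipliers A s HA (eps / 51) ltac:(lra)) as [J [B [HB K]]].
  assert (As := Rabs_pos s).
  destruct (sinc_sq_at_0 (eps / (3 * (Rabs s + 1)))) as [d2 [Hd2 S0]].
  { apply Rdiv_lt_0_compat; lra. }
  assert (PJ := Pmu J). assert (P0 := Pmu 0%nat).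
  assert (HBJ : 0 <= B * mu J) by (apply Rmult_le_pos; lra).
  (* the three error terms are made at most eps / 3 each;
     51 = 3 * 17, where 17 = V + 1 and V = 16 bounds 8 atan *)
  set (d1 := eps / (24 * (B * mu J) + 1)).
  assert (Hd1 : 0 < d1) by (apply Rdiv_lt_0_compat; lra).
  exists (Rmin d1 (d2 / mu 0%nat)). split.
  { apply Rmin_glb_lt; auto. now apply Rdiv_lt_0_compat. }
  intros h L Hh HL.
  assert (M1 := Rmin_l d1 (d2 / mu 0%nat)). assert (M2 := Rmin_r d1 (d2 / mu 0%nat)).
  assert (Pmh : forall j, 0 < mu j * h) by (intros; apply Rmult_lt_0_compat; auto; lra).
  assert (K' := K (fun j => sinc_sq (mu j * h)) (fun j => 8 * atan (mu j * h)) 16 L).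
  simpl in K'.
  assert (X : Rabs (L - s * sinc_sq (mu 0%nat * h))
              <= B * (8 * atan (mu J * h)) + eps / 51 * (16 + 1)).
  { apply K'; auto.
    - intros j. apply sinc_sq_variation; auto. apply Rmult_le_compat_r; auto; lra.
    - intros j. generalize (atan_between (mu j * h)). intros Q.
      specialize (Q ltac:(left; auto)). lra.
    - intros j. now apply sinc_sq_le1. }
  assert (Y : B * (8 * atan (mu J * h)) <= eps / 3).
  { destruct (atan_between (mu J * h)) as [[_ A2] _]; [left; auto|].
    apply Rle_trans with (B * (8 * (mu J * h))); [apply Rmult_le_compat_l; lra|].
    replace (B * (8 * (mu J * h))) with (8 * (B * mu J) * h) by ring.
    apply Rle_trans with (8 * (B * mu J) * d1); [apply Rmult_le_compat_l; lra|].
    assert (D1 : d1 * (24 * (B * mu J) + 1) = eps) by (unfold d1; field; lra).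
    nra. }
  assert (Z : Rabs (s * sinc_sq (mu 0%nat * h) - s) <= eps / 3).
  { replace (s * sinc_sq (mu 0%nat * h) - s) with (s * (sinc_sq (mu 0%nat * h) - 1)) by ring.
    rewrite Rabs_mult.
    assert (mu 0%nat * h < d2).
    { replace d2 with (mu 0%nat * (d2 / mu 0%nat)) by (field; lra).
      apply Rmult_lt_compat_l; auto. lra. }
    specialize (S0 (mu 0%nat * h) ltac:(auto)).
    apply Rle_trans with ((Rabs s + 1) * (eps / (3 * (Rabs s + 1)))).
    - apply Rmult_le_compat; auto using Rabs_pos; lra.
    - right. field. lra. }
  replace (L - s) with ((L - s * sinc_sq (mu 0%nat * h))
     + (s * sinc_sq (mu 0%nat * h) - s)) by ring.
  eapply Rle_trans; [apply Rabs_triang|]. lra.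
Qed.

Definition odd_freq (j : nat) : R := INR (2 * j + 1).

Lemma odd_freq_val j : odd_freq j = 2 * INR j + 1.
Proof. unfold odd_freq. rewrite plus_INR, mult_INR. simpl. ring. Qed.

Lemma odd_freq_pos j : 1 <= odd_freq j.
Proof. rewrite odd_freq_val. generalize (pos_INR j). lra. Qed.

Lemma wave_antiperiodic a b j : antiperiodic (wave a b (odd_freq j)).
Proof.
  intros t. unfold wave.
  replace (odd_freq j * (t + PI)) with (odd_freq j * t + PI + 2 * INR j * PI)
    by (rewrite odd_freq_val; ring).
  rewrite cos_period, sin_period, neg_cos, neg_sin. ring.
Qed.

Lemma wave_second_derivative a b m t :
  Derive (Derive (wave a b m)) t = - m ^ 2 * wave a b m t.
Proof.
  rewrite (Derive_ext _ (fun t => - m * a * sin (m * t) + m * b * cos (m * t))).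
  - apply is_derive_unique. unfold wave. auto_derive; auto. ring.
  - intros u. apply is_derive_unique. unfold wave. auto_derive; auto. ring.
Qed.

Lemma antiperiodic_pair_wave u a b j : Cinf u -> antiperiodic u ->
  RInt (fun t => Derive (Derive u) t * wave a b (odd_freq j) t) 0 PI
  = - odd_freq j ^ 2 * RInt (fun t => u t * wave a b (odd_freq j) t) 0 PI.
Proof.
  intros Hu Au. assert (Hw := Cinf_wave a b (odd_freq j)).
  rewrite antiperiodic_green; auto; [|apply wave_antiperiodic].
  rewrite <- RInt_Cinf_scal by smooth_tac.
  apply RInt_ext. intros t _. rewrite wave_second_derivative. as_real. ring.
Qed.

(** Both waves are eigenfunctions of the second derivative, which is symmetric
    for antiperiodic functions, with different eigenvalues. *)
Lemma wave_orthogonal a b c d i j : i <> j ->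
  RInt (fun t => wave a b (odd_freq i) t * wave c d (odd_freq j) t) 0 PI = 0.
Proof.
  intros N. assert (H1 := Cinf_wave a b (odd_freq i)). assert (H2 := Cinf_wave c d (odd_freq j)).
  assert (E := antiperiodic_pair_wave _ c d j H1 (wave_antiperiodic a b i)).
  rewrite (RInt_ext _ (fun t => - odd_freq i ^ 2 *
    (wave a b (odd_freq i) t * wave c d (odd_freq j) t))) in E.
  2:{ intros t _. rewrite wave_second_derivative. as_real. ring. }
  rewrite RInt_Cinf_scal in E by smooth_tac.
  set (I := RInt (fun t => wave a b (odd_freq i) t * wave c d (odd_freq j) t) 0 PI : R) in *.
  assert (F : (odd_freq i ^ 2 - odd_freq j ^ 2) * I = 0) by lra.
  apply Rmult_integral in F. destruct F as [F|F]; auto. exfalso. apply N.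
  assert (P1 := odd_freq_pos i). assert (P2 := odd_freq_pos j).
  assert (G : (odd_freq i - odd_freq j) * (odd_freq i + odd_freq j) = 0) by lra.
  apply Rmult_integral in G. rewrite !odd_freq_val in *.
  apply INR_eq. lra.
Qed.

(** w'^2 + m^2 w^2 is the constant m^2 (a^2 + b^2), and by parts the two summands
    have the same integral. *)
Lemma wave_norm a b j :
  RInt (fun t => wave a b (odd_freq j) t * wave a b (odd_freq j) t) 0 PI
  = PI / 2 * (a ^ 2 + b ^ 2).
Proof.
  set (m := odd_freq j). assert (Pm : 1 <= m) by apply odd_freq_pos.
  assert (Hw := Cinf_wave a b m). assert (Hw' := Cinf_Derive _ Hw).
  set (I := RInt (fun t => wave a b m t * wave a b m t) 0 PI : R).
  assert (E := antiperiodic_pair_wave _ a b j Hw (wave_antiperiodic a b j)).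
  rewrite antiperiodic_by_parts in E; auto;
    [|apply antiperiodic_Derive; auto; apply wave_antiperiodic|apply wave_antiperiodic].
  fold m in E.
  assert (Sum : RInt (fun t => Derive (wave a b m) t * Derive (wave a b m) t) 0 PI
     + m ^ 2 * I = PI * (m ^ 2 * (a ^ 2 + b ^ 2))).
  { unfold I. rewrite <- RInt_Cinf_scal, <- RInt_Cinf_plus by smooth_tac.
    rewrite (RInt_ext _ (fun _ => m ^ 2 * (a ^ 2 + b ^ 2))).
    - rewrite RInt_const. unfold scal. simpl. unfold mult. simpl.
      now rewrite Rminus_0_r.
    - intros t _.
      replace (Derive (wave a b m) t) with (- m * a * sin (m * t) + m * b * cos (m * t)).
      + assert (X := cos_sin_1 (m * t)). unfold wave. as_real.
        transitivity (m ^ 2 * (a ^ 2 + b ^ 2) *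
          (cos (m * t) * cos (m * t) + sin (m * t) * sin (m * t))); [|rewrite X]; ring.
      + symmetry. apply is_derive_unique. unfold wave. auto_derive; auto. ring. }
  fold I in E.
  set (D := RInt (fun t => Derive (wave a b m) t * Derive (wave a b m) t) 0 PI : R) in *.
  apply (Rmult_eq_reg_l (2 * m ^ 2)); [|nra].
  change (- D = - m ^ 2 * I) in E. change (2 * m ^ 2 * I = 2 * m ^ 2 * (PI / 2 * (a ^ 2 + b ^ 2))).
  change (D + m ^ 2 * I = PI * (m ^ 2 * (a ^ 2 + b ^ 2))) in Sum. lra.
Qed.

Definition riemann_term (al be : nat -> R) (j : nat) (t : R) : R :=
  - / odd_freq j ^ 2 * wave (al j) (be j) (odd_freq j) t.

Lemma Cinf_riemann_term al be j : Cinf (riemann_term al be j).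
Proof.
  assert (H := Cinf_wave (al j) (be j) (odd_freq j)).
  unfold riemann_term. smooth_tac.
Qed.

(** The series integrated twice term by term. *)
Definition riemann_function (al be : nat -> R) (t : R) : R :=
  Series (fun j => riemann_term al be j t).

(** 1 / (2 j + 1)^2 is at most 2 / ((j + 1) (j + 2)), which telescopes. *)
Lemma riemann_term_bound al be M : (forall j, al j ^ 2 + be j ^ 2 <= M) ->
  exists E, is_lim_seq E 0 /\
    forall j t, Rabs (riemann_term al be j t) <= E j - E (S j).
Proof.
  intros HM.
  exists (fun j => 2 * (1 + M) * / INR (S j)). split.
  - replace (Finite 0) with (Rbar_mult (2 * (1 + M)) 0) by (simpl; f_equal; ring).
    apply is_lim_seq_scal_l.
    apply (is_lim_seq_incr_1 (fun j => / INR j)).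
    replace (Finite 0) with (Rbar_inv p_infty) by reflexivity.
    apply is_lim_seq_inv; [apply is_lim_seq_INR|discriminate].
  - intros j t. unfold riemann_term.
    assert (Hw := wave_sq_le (al j) (be j) (odd_freq j) t).
    assert (Aw := Rabs_le_1_sq (wave (al j) (be j) (odd_freq j) t)).
    specialize (HM j). assert (Pm := odd_freq_pos j).
    rewrite Rabs_mult, Rabs_Ropp.
    assert (P2 : 0 < odd_freq j ^ 2) by (apply pow_lt; lra).
    rewrite Rabs_pos_eq by (left; now apply Rinv_0_lt_compat).
    rewrite (S_INR (S j)), (S_INR j). assert (P := pos_INR j).
    set (n := INR j) in *.
    replace (2 * (1 + M) * / (n + 1) - 2 * (1 + M) * / (n + 1 + 1))
      with (2 / ((n + 1) * (n + 2)) * (1 + M)) by (field; lra).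
    assert (W0 := pow2_ge_0 (wave (al j) (be j) (odd_freq j) t)).
    apply Rmult_le_compat; auto using Rabs_pos.
    + left. now apply Rinv_0_lt_compat.
    + replace (2 / ((n + 1) * (n + 2))) with (/ ((n + 1) * (n + 2) / 2)) by (field; lra).
      apply Rinv_le_contravar; [nra|]. rewrite odd_freq_val. fold n. nra.
    + lra.
Qed.

(** cos(u + 2 x) + cos(u - 2 x) - 2 cos u = - 4 sin(x)^2 cos u, and likewise for
    the sine. *)
Lemma riemann_second_difference al be E t h L :
  is_lim_seq E 0 -> (forall j t, Rabs (riemann_term al be j t) <= E j - E (S j)) ->
  0 < h -> L = second_difference (riemann_function al be) t (2 * h) / (4 * h ^ 2) ->
  is_series (fun j => wave (al j) (be j) (odd_freq j) t * sinc_sq (odd_freq j * h)) L.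
Proof.
  intros HE HB Hh ->.
  assert (C : forall t, is_series (fun j => riemann_term al be j t) (riemann_function al be t)).
  { intros s. apply Series_correct. now destruct (telescoping_tail
      (fun j => riemann_term al be j s) E). }
  apply (is_series_ext (fun j => scal (/ (4 * h ^ 2))
    (plus (plus (riemann_term al be j (t + 2 * h)) (riemann_term al be j (t - 2 * h)))
          (scal (-2) (riemann_term al be j t))))).
  - intros j. unfold scal, plus. simpl. unfold mult. simpl.
    unfold riemann_term, wave, sinc_sq. set (m := odd_freq j).
    assert (Pm : 1 <= m) by apply odd_freq_pos.
    replace (m * (t + 2 * h)) with (m * t + 2 * (m * h)) by ring.
    replace (m * (t - 2 * h)) with (m * t - 2 * (m * h)) by ring.
    rewrite cos_plus, cos_minus, sin_plus, sin_minus, cos_2a_sin.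
    as_real. field. split; lra.
  - replace (second_difference (riemann_function al be) t (2 * h) / (4 * h ^ 2)) with
      (scal (/ (4 * h ^ 2)) (plus (plus (riemann_function al be (t + 2 * h))
         (riemann_function al be (t - 2 * h))) (scal (-2) (riemann_function al be t)))).
    + apply (is_series_scal (V := R_NormedModule)).
      apply (is_series_plus (V := R_NormedModule)).
      * apply (is_series_plus (V := R_NormedModule)); apply C.
      * apply (is_series_scal (V := R_NormedModule)), C.
    + unfold second_difference, scal, plus. simpl. unfold mult. simpl. as_real. field. lra.
Qed.

(** F and a double primitive K of q are continuous, and their second difference
    quotients have the same limit q, so by Schwarz's theorem F - K is affine. *)
Lemma riemann_function_smooth al be q E : Cinf q ->
  (forall t, is_series (fun j => wave (al j) (be j) (odd_freq j) t) (q t)) ->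
  is_lim_seq E 0 -> (forall j t, Rabs (riemann_term al be j t) <= E j - E (S j)) ->
  Cinf (riemann_function al be) /\
  forall t, Derive (Derive (riemann_function al be)) t = q t.
Proof.
  intros Hq Sq HE HB. set (F := riemann_function al be).
  set (K1 := fun t => RInt q 0 t : R). set (K := fun t => RInt K1 0 t : R).
  assert (D1 : forall t, is_derive K1 t (q t)) by (intros; now apply is_derive_primitive).
  assert (HK1 : Cinf K1) by now apply Cinf_of_derivative with q.
  assert (D : forall t, is_derive K t (K1 t)) by (intros; now apply is_derive_primitive).
  assert (CF : forall t, continuous F t).
  { intros t. apply normal_series_continuous with E; auto.
    intros j s. apply Cinf_continuous, Cinf_riemann_term. }
  set (G := fun t => F t - K t).
  assert (Aff : forall x, G x = G 0 + x * (G 1 - G 0)).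
  { apply schwarz_affine.
    - intros t. apply (continuous_minus F K); auto.
      apply (ex_derive_continuous K). eexists. apply D.
    - intros x eps He.
      destruct (second_difference_C2 K K1 q x D D1 (Cinf_continuous q x Hq) (eps / 2)
        ltac:(lra)) as [d1 [Hd1 E1]].
      destruct (riemann_summation (fun j => wave (al j) (be j) (odd_freq j) x) odd_freq
        (q x)) with (eps := eps / 2) as [d2 [Hd2 E2]]; auto; try lra.
      + intros j. generalize (odd_freq_pos j). lra.
      + intros j. rewrite !odd_freq_val, S_INR. lra.
      + exists (Rmin d1 (2 * d2)). split; [apply Rmin_glb_lt; lra|].
        intros h Hh. assert (M1 := Rmin_l d1 (2 * d2)). assert (M2 := Rmin_r d1 (2 * d2)).
        specialize (E1 h ltac:(lra)).
        specialize (E2 (h / 2) (second_difference F x h / h ^ 2) ltac:(lra)).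
        assert (E3 : Rabs (second_difference F x h / h ^ 2 - q x) <= eps / 2).
        { apply E2. apply riemann_second_difference with E; auto; [lra|].
          replace (2 * (h / 2)) with h by field.
          replace (4 * (h / 2) ^ 2) with (h ^ 2) by field. reflexivity. }
        assert (P : 0 < h ^ 2) by (apply pow_lt; lra).
        replace (second_difference G x h) with
          ((second_difference F x h / h ^ 2 - q x) * h ^ 2
           - (second_difference K x h - h ^ 2 * q x))
          by (unfold second_difference, G; field; lra).
        eapply Rle_trans; [apply Rabs_triang|]. rewrite Rabs_Ropp, Rabs_mult.
        rewrite (Rabs_pos_eq (h ^ 2)) by lra.
        assert (Rabs (second_difference F x h / h ^ 2 - q x) * h ^ 2 <= eps / 2 * h ^ 2)
          by (apply Rmult_le_compat_r; lra).
        lra. }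
  set (c := G 1 - G 0).
  assert (DF : forall t, is_derive F t (K1 t + c)).
  { intros t. apply is_derive_ext with (fun x => K x + (G 0 + x * c)).
    - intros x. unfold c. rewrite <- Aff. unfold G. as_real. ring.
    - apply (is_derive_plus K (fun x => G 0 + x * c)); auto.
      auto_derive; auto. ring. }
  assert (DF' : forall t, is_derive (fun t => K1 t + c) t (q t)).
  { intros t. rewrite <- (Rplus_0_r (q t)).
    apply (is_derive_plus K1 (fun _ => c)); auto. apply (is_derive_const c). }
  split.
  - apply Cinf_of_derivative with (fun t => K1 t + c); auto.
    now apply Cinf_of_derivative with q.
  - intros t. rewrite (Derive_ext _ (fun t => K1 t + c)).
    + now apply is_derive_unique.
    + intros s. now apply is_derive_unique.
Qed.

Lemma series_single (u : nat -> R) i :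
  (forall j, j <> i -> u j = 0) -> is_series u (u i).
Proof.
  intros Z.
  assert (Low : forall n, (n < i)%nat -> sum_n u n = 0).
  { induction n as [|n IH]; intros Hn.
    - rewrite sum_O. apply Z. lia.
    - rewrite sum_Sn, IH, Z by lia. unfold plus. simpl. as_real. ring. }
  assert (At : sum_n u i = u i).
  { destruct i as [|i]; [apply sum_O|].
    rewrite sum_Sn, Low by lia. unfold plus. simpl. as_real. ring. }
  assert (High : forall k, sum_n u (k + i) = u i).
  { induction k as [|k IH]; [exact At|]. change (S k + i)%nat with (S (k + i)).
    rewrite sum_Sn, IH, (Z (S (k + i))) by lia.
    unfold plus. simpl. as_real. ring. }
  change (is_lim_seq (sum_n u) (u i)).
  apply (is_lim_seq_incr_n _ i).
  apply is_lim_seq_ext with (fun _ => u i); [intros; now rewrite High|].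
  apply is_lim_seq_const.
Qed.

(** Pairing F with a wave leaves a single term of the series, by orthogonality,
    and moving the two derivatives from the wave to F turns it into the pairing
    of q with that wave: this identifies the coefficients. Pairing F with the
    second derivative of h = q + q'' gives the integral of h q on one side and,
    on the other, the factor 1 - m^2 for each frequency m, since h is obtained
    from q by the operator 1 + d^2/dt^2. *)
Lemma trigonometric_energy al be q : Cinf q -> antiperiodic q ->
  (forall t, is_series (fun j => wave (al j) (be j) (odd_freq j) t) (q t)) ->
  is_series (fun j => PI / 2 * ((1 - odd_freq j ^ 2) * (al j ^ 2 + be j ^ 2)))
    (RInt (fun t => (q t + Derive (Derive q) t) * q t) 0 PI).
Proof.
  intros Hq Aq Sq. assert (Hq' := Cinf_Derive q Hq). assert (Hq'' := Cinf_Derive _ Hq').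
  assert (PI0 := PI_RGT_0).
  destruct (cantor_lebesgue_bounded al be odd_freq) as [M [_ HM]].
  { intros j. rewrite odd_freq_val. generalize (pos_INR j). lra. }
  { intros t.
    assert (L : is_lim_seq (fun j => wave (al j) (be j) (odd_freq j) t) 0).
    { apply ex_series_lim_0. now exists (q t). }
    apply is_lim_seq_spec in L. destruct (L (mkposreal 1 Rlt_0_1)) as [J HJ]. simpl in HJ.
    destruct (prefix_bounded (fun j => wave (al j) (be j) (odd_freq j) t) J)
      as [B [HB PB]].
    exists (B + 1). intros j. destruct (Nat.lt_ge_cases j J) as [C|C].
    - specialize (PB j C). lra.
    - specialize (HJ j C). rewrite Rminus_0_r in HJ. lra. }
  destruct (riemann_term_bound al be M HM) as [E [HE HB]].
  destruct (riemann_function_smooth al be q E Hq Sq HE HB) as [HF DF].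
  set (F := riemann_function al be) in *.
  assert (AF : antiperiodic F).
  { intros t. unfold F, riemann_function. rewrite <- Series_opp. apply Series_ext.
    intros j. unfold riemann_term. rewrite wave_antiperiodic. ring. }
  assert (Int : forall psi, Cinf psi ->
    is_series (fun j => RInt (fun t => riemann_term al be j t * psi t) 0 PI)
              (RInt (fun t => F t * psi t) 0 PI)).
  { intros psi Hpsi. apply normal_series_RInt with E; auto; try lra.
    - intros j t. apply Cinf_continuous, Cinf_riemann_term.
    - intros t. now apply Cinf_continuous. }
  assert (Hw : forall j, Cinf (wave (al j) (be j) (odd_freq j)))
    by (intros; apply Cinf_wave).
  assert (Aw : forall j, antiperiodic (wave (al j) (be j) (odd_freq j)))
    by (intros; apply wave_antiperiodic).
  assert (IntW : forall j psi, Cinf psi ->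
    RInt (fun t => riemann_term al be j t * psi t) 0 PI
    = - / odd_freq j ^ 2 * RInt (fun t => psi t * wave (al j) (be j) (odd_freq j) t) 0 PI).
  { intros j psi Hpsi. specialize (Hw j). rewrite <- RInt_Cinf_scal by smooth_tac.
    apply RInt_ext. intros t _. unfold riemann_term. as_real. ring. }
  assert (Coef : forall i, RInt (fun t => q t * wave (al i) (be i) (odd_freq i) t) 0 PI
                  = PI / 2 * (al i ^ 2 + be i ^ 2)).
  { intros i. assert (S := Int _ (Hw i)).
    assert (Pi' := odd_freq_pos i).
    assert (S' : is_series (fun j => RInt (fun t => riemann_term al be j t
         * wave (al i) (be i) (odd_freq i) t) 0 PI)
       (- / odd_freq i ^ 2 * (PI / 2 * (al i ^ 2 + be i ^ 2)))).
    { rewrite <- (wave_norm (al i) (be i) i), <- IntW by auto.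
      refine (series_single (fun j => RInt (fun t => riemann_term al be j t
         * wave (al i) (be i) (odd_freq i) t) 0 PI : R) i _).
      intros j N. rewrite IntW, wave_orthogonal by auto.
      as_real. ring. }
    assert (U := is_series_unique _ _ S). rewrite (is_series_unique _ _ S') in U.
    assert (P := antiperiodic_pair_wave F (al i) (be i) i HF AF).
    rewrite (RInt_ext _ (fun t => q t * wave (al i) (be i) (odd_freq i) t)) in P
      by (intros t _; now rewrite DF).
    rewrite P, <- U. as_real. field. lra. }
  set (h := fun t => q t + Derive (Derive q) t).
  assert (Hh : Cinf h) by (unfold h; smooth_tac).
  assert (Ah : antiperiodic h).
  { intros t. unfold h. rewrite Aq, !antiperiodic_Derive; auto using antiperiodic_Derive.
    ring. }
  assert (S := Int _ (Cinf_Derive _ (Cinf_Derive _ Hh))).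
  rewrite <- antiperiodic_green in S by auto.
  rewrite (RInt_ext _ (fun t => h t * q t)) in S
    by (intros t _; rewrite DF; apply Rmult_comm).
  eapply is_series_ext; [|exact S].
  intros j. cbv beta. assert (Pj := odd_freq_pos j). specialize (Hw j). specialize (Aw j).
  rewrite IntW by now apply Cinf_Derive, Cinf_Derive.
  rewrite antiperiodic_pair_wave by auto.
  rewrite (RInt_ext (fun t => h t * _ t) (fun t => q t * wave (al j) (be j) (odd_freq j) t
     + Derive (Derive q) t * wave (al j) (be j) (odd_freq j) t))
    by (intros t _; apply Rmult_plus_distr_r).
  rewrite RInt_Cinf_plus by smooth_tac.
  rewrite antiperiodic_pair_wave, Coef by auto. as_real. field. lra.
Qed.

(** * The area formula *)

Theorem proposition4p5 :
  forall (C : plane -> Prop) (p : plane),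
    is_oval C -> int_region C p ->
    let q := offset C p in
    let A := oriented_area (ART C p) 0 PI in
    A = / 2 * RInt (fun t => q t ^ 2 - Derive q t ^ 2) 0 PI
    /\ A <= 0
    /\ (forall a b : nat -> R,
          (forall t : R,
             is_series
               (fun j : nat =>
                  let k := (2 * j + 1)%nat in
                  a k * cos (INR k * t) + b k * sin (INR k * t))
               (q t)) ->
          let term := fun j : nat =>
            let k := (2 * j + 3)%nat in
            (INR k ^ 2 - 1) * (a k ^ 2 + b k ^ 2) in
          ex_series term /\ A = - (PI / 4) * Series term)
    /\ (A = 0 <-> exists c : plane, forall t : R, ART C p t = c).
Proof.
  intros C p HC Hp q A.
  destruct (offset_smooth C p HC Hp) as [Hq Aq]. fold q in Hq, Aq.
  assert (Area2 : A = / 2 * RInt (fun t => (q t + Derive (Derive q) t) * q t) 0 PI)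
    by now apply envelope_area_second_order.
  assert (Energy := RInt_energy q Hq Aq).
  split; [now apply envelope_area|]. split; [|split].
  - assert (W := wirtinger q Hq Aq). rewrite Energy in W. rewrite Area2.
    lra.
  - intros a b Sq term.
    assert (Sr := trigonometric_energy (fun j => a (2 * j + 1)%nat)
                   (fun j => b (2 * j + 1)%nat) q Hq Aq Sq).
    set (I := RInt (fun t => (q t + Derive (Derive q) t) * q t) 0 PI : R) in *.
    assert (PI0 := PI_RGT_0).
    assert (S0 : is_series (fun j => PI / 2 * ((1 - odd_freq (S j) ^ 2)
      * (a (2 * S j + 1)%nat ^ 2 + b (2 * S j + 1)%nat ^ 2))) I).
    { apply (is_series_incr_1 (fun j => PI / 2 * ((1 - odd_freq j ^ 2)
        * (a (2 * j + 1)%nat ^ 2 + b (2 * j + 1)%nat ^ 2)))).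
      replace (plus I _) with I; [exact Sr|].
      unfold plus. simpl. rewrite odd_freq_val. simpl. ring. }
    assert (S1 : is_series term (- (4 / PI) * A)).
    { apply (is_series_scal (V := R_NormedModule) (- (2 / PI))) in S0.
      replace (- (4 / PI) * A) with (scal (- (2 / PI)) I).
      - apply is_series_ext with (2 := S0). intros j.
        change (- (2 / PI) * (PI / 2 * ((1 - odd_freq (S j) ^ 2)
          * (a (2 * S j + 1)%nat ^ 2 + b (2 * S j + 1)%nat ^ 2))) = term j).
        unfold term, odd_freq. cbv zeta.
        replace (2 * S j + 1)%nat with (2 * j + 3)%nat by lia.
        field. lra.
      - rewrite Area2. fold I. unfold scal. simpl. unfold mult. simpl. field. lra. }
    split; [eexists; exact S1|].
    rewrite (is_series_unique _ _ S1). field. apply PI_neq0.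
  - unfold ART. fold q. rewrite (envelope_constant_iff p q Hq). split.
    + intros Z. apply wirtinger_equality; auto. rewrite Energy.
      rewrite Area2 in Z. lra.
    + intros Z. rewrite Area2.
      rewrite (RInt_ext _ (fun _ => 0)).
      * rewrite RInt_const. unfold scal. simpl. unfold mult. simpl. ring.
      * intros t _. rewrite Z. apply Rmult_0_l.
Qed.
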